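(* Let $L$ be the Lagrangian of a Chaplygin system on $Q$ with symmetry group $G$, constraint distribution $\mathcal D$ and constraint submanifold $\mathcal C\subset TQ$. If $L$ is regular with respect to $\mathcal D$ and to $\mathfrak g$, then the function $\tilde L=L-p_av^a$ is regular in some neighbourhood of $\mathcal C$ and invariant under the action of $G$ on $TQ$. Moreover, the corresponding Euler-Lagrange field $\tilde\Gamma$ (defined in such a neighbourhood) is tangent to $\mathcal C$.
   Context: Considerations are local (over the domain of the frame below). Summation convention. $\tau:TQ\to Q$; local coordinates $q^i$ on $Q$, fibre coordinates $u^i$ on $TQ$. For a vector field $Z=Z^i\,\partial/\partial q^i$ on $Q$: complete lift $Z^{\mathrm C}=Z^i\frac{\partial}{\partial q^i}+u^j\frac{\partial Z^i}{\partial q^j}\frac{\partial}{\partial u^i}$, vertical lift $Z^{\mathrm V}=Z^i\frac{\partial}{\partial u^i}$. Chaplygin system: a Lie group $G$ (with Lie algebra $\mathfrak g$) acts freely and properly on the $n$-dimensional manifold $Q$, so $Q\to Q/G$ is a principal bundle; $L$ is a smooth function on $TQ$ invariant under the induced action of $G$ on $TQ$; and the (non-integrable, rank $m$) constraint distribution $\mathcal D$ is the horizontal distribution of a principal connection on $Q\to Q/G$. $\mathcal C=\{(q,u)\in TQ:u\in\mathcal D_q\}$. Frame: $\{X_i\}=\{X_\alpha,X_a=\tilde E_a\}$, $\alpha=1,\dots,m$, $a=m+1,\dots,n$, where the $\tilde E_a$ are the fundamental vector fields of the action corresponding to a basis of $\mathfrak g$, so that $[\tilde E_a,\tilde E_b]=-C_{ab}^c\tilde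 E_c$ with $C^c_{ab}$ the structure constants, and the $X_\alpha$ are $G$-invariant vector fields spanning $\mathcal D$, so $[\tilde E_a,X_\alpha]=0$. With dual coframe $\{\theta^i\}$, the quasi-velocities are $v^i(q,u)=\theta^i_q(u)$; $\mathcal C$ is given by $v^a=0$. Momentum components: $p_a=\tilde E_a^{\mathrm V}(L)$, functions on $TQ$. With $g_{ij}=X_i^{\mathrm V}(X_j^{\mathrm V}(L))$: $L$ is regular with respect to $\mathcal D$ if $(g_{\alpha\beta})$ is nonsingular on $\mathcal C$, and regular with respect to $\mathfrak g$ if the submatrix $(g_{ab})=(\tilde E_a^{\mathrm V}(\tilde E_b^{\mathrm V}(L)))$ is nonsingular. A Lagrangian is regular on an open set if its full velocity Hessian is nonsingular there; its Euler-Lagrange field is then the unique second-order differential equation field $\tilde\Gamma$ there ($\tau_{*(q,u)}\tilde\Gamma=u$) with $\tilde\Gamma(X_i^{\mathrm V}(\tilde L))-X_i^{\mathrm C}(\tilde L)=0$ for $i=1,\dots,n$. *)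

(* Defs.v *)
From HB Require Import structures.
From mathcomp Require Import all_boot all_order all_algebra.
From mathcomp Require Import all_classical all_reals all_analysis.
Set Implicit Arguments.
Unset Strict Implicit.
Unset Printing Implicit Defensive.
Import Order.TTheory GRing.Theory Num.Theory numFieldNormedType.Exports.
Local Open Scope classical_set_scope.
Local Open Scope ring_scope.

(* C^r on A.  For finite-dimensional V (the only case used) this is the usual
   notion: f is differentiable on A and its directional derivatives are
   C^(r-1).  It is only applied to open sets A. *)
Fixpoint Cdiff (R : realType) (V W : normedModType R) (r : nat) (A : set V)
    (f : V -> W) : Prop :=
  if r is r'.+1 then
    (forall x, A x -> differentiable f x) /\
    (forall v, Cdiff r' A (fun x => 'D_v f x))
  else forall x, A x -> {for x, continuous f}.

Definition smooth_on (R : realType) (V W : normedModType R) (A : set V)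
    (f : V -> W) : Prop :=
  forall r, Cdiff r A f.

(* An n-dimensional smooth structure on the space M.  The atlas is indexed by
   the points of M: [chart p], with domain [chart_dom p] and inverse
   [chart_inv p], is a chart around p.  Every smooth atlas contains, after
   reindexing, one of this form defining the same smooth structure.

   The chart [chart p] also fixes a coordinate identification of T_p M with
   R^n, so that a tangent vector at p is an element of 'rV[R]_n, a vector field
   is a map M -> 'rV[R]_n, and TM is M * 'rV[R]_n as a set; its topology and
   smooth structure are not those of the product, they are given by the
   coordinates [tchart] below. *)
Record manifold (R : realType) (n : nat) (M : topologicalType) := Manifold {
  chart_dom : M -> set M;
  chart : M -> M -> 'rV[R]_n;
  chart_inv : M -> 'rV[R]_n -> M;
  chart_dom_center : forall p, chart_dom p p;
  chart_dom_open : forall p, open (chart_dom p);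
  chart_img_open : forall p, open (chart p @` chart_dom p);
  chartK : forall p q, chart_dom p q -> chart_inv p (chart p q) = q;
  chart_continuous : forall p q, chart_dom p q -> {for q, continuous (chart p)};
  chart_inv_continuous : forall p x, (chart p @` chart_dom p) x ->
    {for x, continuous (chart_inv p)};
  chart_transition : forall p p',
    smooth_on (chart p @` (chart_dom p `&` chart_dom p'))
      (chart p' \o chart_inv p);
  manifold_hausdorff : hausdorff_space M;
  manifold_second_countable : @second_countable M
}.

Definition chart_img (R : realType) (n : nat) (M : topologicalType)
    (MM : manifold R n M) (p : M) : set 'rV[R]_n :=
  chart MM p @` chart_dom MM p.

Definition smooth_map (R : realType) (n n' : nat) (M N : topologicalType)
    (MM : manifold R n M) (MN : manifold R n' N) (f : M -> N) : Prop :=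
  continuous f /\
  forall p p', smooth_on
    [set x | chart_img MM p x /\ chart_dom MN p' (f (chart_inv MM p x))]
    (fun x => chart MN p' (f (chart_inv MM p x))).

(* Smoothness of a map M x N -> P, in the product charts of M x N. *)
Definition smooth_map2 (R : realType) (n n' n'' : nat)
    (M N P : topologicalType) (MM : manifold R n M) (MN : manifold R n' N)
    (MP : manifold R n'' P) (f : M -> N -> P) : Prop :=
  continuous (fun z : M * N => f z.1 z.2) /\
  forall p p' p'', smooth_on
    [set z : 'rV[R]_n * 'rV[R]_n' |
      [/\ chart_img MM p z.1, chart_img MN p' z.2
        & chart_dom MP p'' (f (chart_inv MM p z.1) (chart_inv MN p' z.2))]]
    (fun z => chart MP p'' (f (chart_inv MM p z.1) (chart_inv MN p' z.2))).

(* The tangent map T_p f : T_p M -> T_(f p) N. *)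
Definition tmap (R : realType) (n n' : nat) (M N : topologicalType)
    (MM : manifold R n M) (MN : manifold R n' N) (f : M -> N) (p : M)
    (u : 'rV[R]_n) : 'rV[R]_n' :=
  'D_u (fun x => chart MN (f p) (f (chart_inv MM p x))) (chart MM p p).

Section TangentBundle.
Variables (R : realType) (n : nat) (Q : topologicalType).
Variable MQ : manifold R n Q.
Local Notation V := 'rV[R]_n.
Local Notation TQ := (Q * V)%type.

(* The coordinates (q^i, u^i) induced on TQ by [chart p], and their inverse. *)
Definition tchart (p : Q) (z : TQ) : V * V :=
  (chart MQ p z.1,
   'D_(z.2) (chart MQ p \o chart_inv MQ z.1) (chart MQ z.1 z.1)).

Definition tchart_inv (p : Q) (y : V * V) : TQ :=
  (chart_inv MQ p y.1,
   'D_(y.2) (chart MQ (chart_inv MQ p y.1) \o chart_inv MQ p) y.1).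

Definition tchart_dom (p : Q) (N : set TQ) : set (V * V) :=
  [set y | chart_img MQ p y.1 /\ N (tchart_inv p y)].

Definition topen (N : set TQ) : Prop := forall p, open (tchart_dom p N).

Definition tsmooth (N : set TQ) (F : TQ -> R) : Prop :=
  forall p, smooth_on (tchart_dom p N) (F \o tchart_inv p).

(* The coordinates of z = (q, u) in the chart at its own base point; the second
   component of [tchart z.1 z] is indeed z.2. *)
Definition tcenter (z : TQ) : V * V := (chart MQ z.1 z.1, z.2).

(* A vector field A on TQ is given by its components
   A z = (a, b), standing for a^i d/dq^i + b^i d/du^i, in the coordinates [tchart z.1]. *)
Definition tderiv (A : TQ -> V * V) (F : TQ -> R) (z : TQ) : R :=
  'D_(A z) (F \o tchart_inv z.1) (tcenter z).

Definition tvf_smooth (N : set TQ) (A : TQ -> V * V) : Prop :=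
  forall p, smooth_on (tchart_dom p N)
    (fun y => let z := tchart_inv p y in
      'D_(A z) (tchart p \o tchart_inv z.1) (tcenter z)).

(* The components of the vector field Z on Q in the coordinates [chart p]. *)
Definition vf_in (p : Q) (Z : Q -> V) (x : V) : V :=
  let q := chart_inv MQ p x in (tchart p (q, Z q)).2.

Definition vf_smooth (U : set Q) (Z : Q -> V) : Prop :=
  forall p, smooth_on (chart MQ p @` (chart_dom MQ p `&` U)) (vf_in p Z).

Definition complete_lift (Z : Q -> V) (z : TQ) : V * V :=
  (Z z.1, 'D_(z.2) (vf_in z.1 Z) (chart MQ z.1 z.1)).

Definition vertical_lift (Z : Q -> V) (z : TQ) : V * V := (0, Z z.1).

(* The velocity Hessian d^2 F / du^i du^j. *)
Definition hessian (F : TQ -> R) (z : TQ) : 'M[R]_n :=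
  \matrix_(i, j) 'D_((0, delta_mx 0 i) : V * V)
    (fun y => 'D_((0, delta_mx 0 j) : V * V) (F \o tchart_inv z.1) y)
    (tcenter z).

Definition regular_on (N : set TQ) (F : TQ -> R) : Prop :=
  tsmooth N F /\ forall z, N z -> hessian F z \in unitmx.

Definition second_order_field (N : set TQ) (A : TQ -> V * V) : Prop :=
  tvf_smooth N A /\ forall z, N z -> (A z).1 = z.2.

(* A is tangent to S at z: A z is the velocity at z of a smooth curve in S. *)
Definition tangent_at (S : set TQ) (A : TQ -> V * V) (z : TQ) : Prop :=
  exists (c : R -> TQ) (I : set R),
    [/\ open I /\ I 0,
        c 0 = z,
        forall t, I t -> S (c t) /\ chart_dom MQ z.1 (c t).1,
        smooth_on I (tchart z.1 \o c)
      & 'D_1 (tchart z.1 \o c) 0 = A z].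

Definition smooth_distribution (m : nat) (D : Q -> {vspace V}) : Prop :=
  (forall q, \dim (D q) = m) /\
  forall q0, exists (U : set Q) (X : 'I_m -> Q -> V),
    [/\ open U, U q0, forall al, vf_smooth U (X al)
      & forall q, U q -> D q = <<[tuple X al q | al < m]>>%VS].

(* Through every point there passes an integral manifold of D: there is a smooth
   s : A -> Q, with A an open neighbourhood of 0 in R^m, such that the image of
   T_x s is D_(s x) for all x in A. *)
Definition integrable_distribution (m : nat) (D : Q -> {vspace V}) : Prop :=
  forall q, exists (A : set 'rV[R]_m) (s : 'rV[R]_m -> Q),
    [/\ open A /\ A 0,
        s 0 = q,
        forall x, A x -> {for x, continuous s},
        forall p, smooth_on [set x | A x /\ chart_dom MQ p (s x)]
          (chart MQ p \o s)
      & forall x, A x ->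
          range (fun w => 'D_w (chart MQ (s x) \o s) x) = [set` D (s x)]].

Definition constraint_set (D : Q -> {vspace V}) : set TQ :=
  [set z | z.2 \in D z.1].

End TangentBundle.

HB.structure Definition GroupSpace := {G of Group G & Topological G}.

Definition is_lie_group (R : realType) (k : nat) (G : GroupSpace.type)
    (MG : manifold R k G) : Prop :=
  smooth_map2 MG MG MG (fun g h : G => (g * h)%g) /\
  smooth_map MG MG (fun g : G => (g^-1)%g).

Section Chaplygin.
Variables (R : realType) (m k : nat) (Q : topologicalType) (G : GroupSpace.type).
(* n = m + k, with m the rank of the constraint distribution and k = dim G. *)
Variables (MQ : manifold R (m + k) Q) (MG : manifold R k G).
Variable act : G -> Q -> Q.
Local Notation V := 'rV[R]_(m + k).
Local Notation TQ := (Q * V)%type.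

Definition is_action : Prop :=
  (forall q, act 1%g q = q) /\
  (forall g h q, act (g * h)%g q = act g (act h q)).

Definition free_action : Prop := forall g q, act g q = q -> g = 1%g.

Definition proper_action : Prop :=
  forall K : set (Q * Q), compact K ->
    compact [set z : G * Q | K (act z.1 z.2, z.2)].

Definition tact (g : G) (z : TQ) : TQ :=
  (act g z.1, tmap MQ MQ (act g) z.1 z.2).

Definition invariant_set (W : set Q) : Prop := forall g q, W q -> W (act g q).

Definition invariant_function_on (W : set Q) (F : TQ -> R) : Prop :=
  forall g z, W z.1 -> F (tact g z) = F z.

(* The Lie algebra of G is T_1 G = 'rV[R]_k; the fundamental vector field of xi
   is q |-> T_1 (g |-> g q) xi. *)
Definition fundamental (xi : 'rV[R]_k) (q : Q) : V :=
  tmap MG MQ (act^~ q) 1%g xi.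

Definition vertical_space (q : Q) : set V := range (fundamental ^~ q).

(* The horizontal distribution of a principal connection: a smooth G-invariant
   distribution complementary to the tangent spaces of the orbits. *)
Definition principal_connection (D : Q -> {vspace V}) : Prop :=
  [/\ smooth_distribution MQ m D,
      forall q (u : V), exists2 w, w \in D q & vertical_space q (u - w),
      forall q, [set` D q] `&` vertical_space q = [set 0]
    & forall g q, tmap MQ MQ (act g) q @` [set` D q] = [set` D (act g q)]].

Record chaplygin_system (L : TQ -> R) (D : Q -> {vspace V}) : Prop := {
  chaplygin_lie_group : is_lie_group MG;
  chaplygin_action : is_action;
  chaplygin_action_smooth : smooth_map2 MG MQ MQ act;
  chaplygin_free : free_action;
  chaplygin_proper : proper_action;
  chaplygin_connection : principal_connection D;
  chaplygin_nonintegrable : ~ integrable_distribution MQ m D;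
  chaplygin_smooth : tsmooth MQ setT L;
  chaplygin_invariant : invariant_function_on setT L
}.

Variables (bg : k.-tuple 'rV[R]_k) (W : set Q) (X : 'I_m -> Q -> V).

Definition E_ (a : 'I_k) : Q -> V := fundamental (tnth bg a).

Definition frame (i : 'I_(m + k)) : Q -> V :=
  match fintype.split i with inl al => X al | inr a => E_ a end.

Definition frame_at (q : Q) : (m + k).-tuple V :=
  [tuple frame i q | i < m + k].

Record adapted_frame (D : Q -> {vspace V}) : Prop := {
  frame_dom_open : open W;
  frame_dom_invariant : invariant_set W;
  frame_lie_basis : basis_of fullv bg;
  frame_smooth : forall al, vf_smooth MQ W (X al);
  frame_span : forall q, W q -> D q = <<[tuple X al q | al < m]>>%VS;
  frame_invariant : forall al g q, W q ->
    tmap MQ MQ (act g) q (X al q) = X al (act g q);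
  frame_basis : forall q, W q -> basis_of fullv (frame_at q)
}.

(* v^i (q, u) = theta^i_q (u), with theta^i the dual coframe. *)
Definition quasi_velocity (i : 'I_(m + k)) (z : TQ) : R :=
  coord (frame_at z.1) i z.2.

Definition Vderiv (Z : Q -> V) (F : TQ -> R) : TQ -> R :=
  tderiv MQ (vertical_lift Z) F.

Definition Cderiv (Z : Q -> V) (F : TQ -> R) : TQ -> R :=
  tderiv MQ (complete_lift MQ Z) F.

Definition momentum (L : TQ -> R) (a : 'I_k) : TQ -> R := Vderiv (E_ a) L.

Definition Ltilde (L : TQ -> R) (z : TQ) : R :=
  L z - \sum_(a < k) momentum L a z * quasi_velocity (rshift m a) z.

Definition over : set TQ := [set z | W z.1].

Definition regular_wrt_D (L : TQ -> R) (D : Q -> {vspace V}) : Prop :=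
  forall z, over z -> constraint_set D z ->
    (\matrix_(al < m, be < m) Vderiv (X al) (Vderiv (X be) L) z) \in unitmx.

Definition regular_wrt_g (L : TQ -> R) : Prop :=
  forall z, over z ->
    (\matrix_(a < k, b < k) Vderiv (E_ a) (Vderiv (E_ b) L) z) \in unitmx.

Definition euler_lagrange_field (F : TQ -> R) (N : set TQ)
    (Gam : TQ -> V * V) : Prop :=
  second_order_field MQ N Gam /\
  forall z, N z -> forall i,
    tderiv MQ Gam (Vderiv (frame i) F) z - Cderiv (frame i) F z = 0.

Definition constraint_nbhd (D : Q -> {vspace V}) (N : set TQ) : Prop :=
  [/\ topen MQ N, N `<=` over & constraint_set D `&` over `<=` N].

End Chaplygin.

(* Main.v *)
(* Everything is computed in charts, where regularity, the Euler-Lagrange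
   equations and the lifts are shown not to depend on the chart.  From
   E_b^V(L - p_a v^a) = - g_ba v^a it follows that at a point of C the velocity
   Hessian of L - p_a v^a, written in the frame, is block triangular with
   diagonal blocks (g_al,be) and - (g_ab)^T; hence it is nonsingular near C.
   The function p_a v^a is the fibre derivative of L along the vertical part of
   the velocity, which makes its invariance visible.  By invariance
   E_b^C(L - p_a v^a) = 0, so the Euler-Lagrange equations along E_b give
   g_ba Gamma(v^a) = 0 on C; hence Gamma(v^a) = 0 there, and Gamma is the velocity
   of a curve of the form (x(t), sum_al c_al(t) X_al(x(t))). *)
From HB Require Import structures.
Require Import Defs.
From mathcomp Require Import all_boot all_order all_algebra.
From mathcomp Require Import all_classical all_reals all_analysis.
Import Order.TTheory GRing.Theory Num.Theory numFieldNormedType.Exports.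
Local Open Scope classical_set_scope.
Local Open Scope ring_scope.
Set Implicit Arguments.
Unset Strict Implicit.
Unset Printing Implicit Defensive.

(** A tangent vector at q is stored in the coordinates of the chart at q itself. The chart in which
    [tderiv], [hessian] and the lifts are evaluated therefore changes with the point, and none of
    them can be differentiated again as it stands. Each is first moved to one fixed chart, where it
    becomes an expression on an open subset of R^n x R^n. Fibre derivatives transfer easily, a
    change of chart being linear on the fibres. The complete lift carries a second derivative of the
    transition map: this is one use of Schwarz's theorem. The other is the infinitesimal form of the
    invariance, where a group derivative and a derivative along the velocity are exchanged.
    Subtracting p_a v^a cancels on C the mixed block g_(al,b) of the Hessian of L. This is why
    separate conditions on the two diagonal blocks suffice, although L itself may be singular there.
    Off C nothing is known about the determinant of the new Hessian beyond its continuity, so the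
    neighbourhood is the set where it does not vanish. *)

(** * Calculus of smooth maps *)

(* Finite dimensionality, in the form needed to reduce the chain rule for C^r
   maps and the symmetry of second derivatives to real-valued functions. *)
Class finite_coords (R : realType) (V : normedModType R) : Prop :=
  finite_coords_ex : exists (d : nat) (e : 'I_d -> V) (c : 'I_d -> {linear V -> R}),
    (forall i, continuous (c i)) /\ forall x, x = \sum_i c i x *: e i.

Definition linear_pack (R : realType) (V W : lmodType R) (f : V -> W)
    (lf : linear f) : {linear V -> W} :=
  HB.pack f (GRing.isLinear.Build _ _ _ _ _ lf).

Lemma finite_coords_R (R : realType) : @finite_coords R R.
Proof.
exists 1%N, (fun=> 1), (fun=> idfun); split=> [i|x]; first by move=> x; exact: cvg_id.
by rewrite big_ord1 /= [RHS]mulr1.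
Qed.
#[export] Existing Instance finite_coords_R.

Lemma finite_coords_rV (R : realType) n : finite_coords ('rV[R]_n : normedModType R).
Proof.
have lin (i : 'I_n) : linear (fun x : 'rV[R]_n => x 0 i : R).
  by move=> a x y; rewrite !mxE.
exists n, (fun i => delta_mx 0 i),
  (fun i => linear_pack (lin i)); split=> [i|x] /=.
  exact: coord_continuous.
exact: row_sum_delta.
Qed.
#[export] Existing Instance finite_coords_rV.

Lemma finite_coords_prod (R : realType) (V W : normedModType R) :
  finite_coords V -> finite_coords W -> finite_coords ((V * W)%type : normedModType R).
Proof.
move=> [d [e [c [cc ce]]]] [d' [e' [c' [cc' ce']]]].
pose g (i : 'I_(d + d')) (x : V * W) : R :=
  match fintype.split i with inl j => c j x.1 | inr j => c' j x.2 end.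
have lin i : linear (g i).
  by move=> a x y; rewrite /g; case: fintype.split => j; rewrite linearP.
exists (d + d')%N, (fun i => match fintype.split i with
  inl j => (e j, 0) | inr j => (0, e' j) end),
  (fun i => linear_pack (lin i)); split=> [i|x] /=.
  rewrite /g; case: fintype.split => j x.
    apply: (@continuous_comp _ _ _ fst (c j)); [exact: cvg_fst | exact: cc].
  apply: (@continuous_comp _ _ _ snd (c' j)); [exact: cvg_snd | exact: cc'].
rewrite big_split_ord /= /g.
under eq_bigr do rewrite (unsplitK (inl _)) /=.
under [X in _ + X]eq_bigr do rewrite (unsplitK (inr _)) /=.
case: x => x y /=; rewrite [X in (X, _)]ce [X in (_, X)]ce'.
have pr (I : finType) (F : I -> V) (G : I -> W) :
    \sum_i (F i, G i) = (\sum_i F i, \sum_i G i) :> V * W.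
  by elim/big_rec3: _ => [|i ? ? ? _ ->].
have -> : \sum_(i < d) c i x *: ((e i, 0) : V * W) =
    \sum_(i < d) ((c i x *: e i, 0) : V * W).
  by apply: eq_bigr => i _; congr (_, _); rewrite /= ?scaler0.
have -> : \sum_(i < d') c' i y *: ((0, e' i) : V * W) =
    \sum_(i < d') ((0, c' i y *: e' i) : V * W).
  by apply: eq_bigr => i _; congr (_, _); rewrite /= ?scaler0.
rewrite !pr ![\sum_i 0]big1 //.
by rewrite -[RHS]/(_ + 0, 0 + _) addr0 add0r.
Qed.
#[export] Existing Instance finite_coords_prod.

Section Calculus.
Context {R : realType}.
Implicit Types U V W : normedModType R.

(** Differentiability is a first-order expansion at the point; g inherits that of f, with the same
    differential, because both sides agree near x. *)
Lemma differentiable_near_eq V W (f g : V -> W) x :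
  (\near x, f x = g x) -> differentiable f x -> differentiable g x.
Proof.
move=> fg df.
have gE : g \o shift x = cst (g x) + 'd f x +o_ 0 id.
  apply/eqaddoP => _/posnumP[e].
  have /eqaddoP/(_ e%:num) /(_ [gt0 of e%:num]) := diff_locally df.
  apply: filter_app.
  have : \forall h \near 0, f (h + x) = g (h + x).
    by move: fg; rewrite (near_shift 0) /=; apply: filterS => h /=; rewrite subr0.
  apply: filterS => h /= fgh.
  rewrite /= -![(_ + _ : _ -> _) _]/(_ + _) -![(- _ : _ -> _) _]/(- _) /= /cst.
  by rewrite -fgh -(nbhs_singleton fg).
have dE : 'd g x = 'd f x :> (V -> W).
  by apply: diff_unique => //; exact: diff_continuous.
by apply/diff_locallyP; rewrite dE; split=> //; exact: diff_continuous.
Qed.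

Lemma open_near V (A : set V) x : open A -> A x -> \near x, A x.
Proof. by move=> oA Ax; exact: open_nbhs_nbhs. Qed.

Lemma open_eq_near V W (A : set V) (f g : V -> W) x : open A -> A x ->
  (forall y, A y -> f y = g y) -> \near x, f x = g x.
Proof. by move=> oA Ax fg; near=> y; apply: fg; near: y; exact: open_near.
Unshelve. all: by end_near. Qed.

Lemma derive_open_eq V W (A : set V) (f g : V -> W) x v : open A -> A x ->
  (forall y, A y -> f y = g y) -> 'D_v f x = 'D_v g x.
Proof. by move=> oA Ax fg; apply: near_eq_derive; exact: open_eq_near fg. Qed.

Lemma derive_comp U V W (f : U -> V) (g : V -> W) x v :
  differentiable f x -> differentiable g (f x) ->
  'D_v (fun x => g (f x)) x = 'D_('D_v f x) g (f x).
Proof.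
move=> df dg.
have dgf : differentiable (g \o f) x by exact: differentiable_comp.
rewrite -[LHS]/('D_v (g \o f) x) (deriveE v dgf) (deriveE _ dg) (deriveE _ df).
by have /(congr1 (@^~ v)) := diff_comp df dg.
Qed.

Lemma derive_dirP V W (f : V -> W) x a v w : differentiable f x ->
  'D_(a *: v + w) f x = a *: 'D_v f x + 'D_w f x.
Proof. by move=> df; rewrite !deriveE // linearP. Qed.

Lemma derive_dirD V W (f : V -> W) x v w : differentiable f x ->
  'D_(v + w) f x = 'D_v f x + 'D_w f x.
Proof. by move=> df; rewrite !deriveE // linearD. Qed.

Lemma derive_dirZ V W (f : V -> W) x a v : differentiable f x ->
  'D_(a *: v) f x = a *: 'D_v f x.
Proof. by move=> df; rewrite !deriveE // linearZ. Qed.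

Lemma derive_dir_sum V W (f : V -> W) x (I : finType) (P : pred I) (v : I -> V) :
  differentiable f x ->
  'D_(\sum_(i | P i) v i) f x = \sum_(i | P i) 'D_(v i) f x.
Proof.
by move=> df; rewrite deriveE // linear_sum; apply: eq_bigr => i _; rewrite deriveE.
Qed.

Lemma derive_lin V W (f : {linear V -> W}) x v : continuous f -> 'D_v f x = f v.
Proof.
by move=> cf; rewrite deriveE ?diff_lin //; exact: linear_differentiable.
Qed.

Lemma derive_linear_comp V W U (l : {linear W -> U}) (f : V -> W) x v :
  continuous l -> differentiable f x -> 'D_v (fun x => l (f x)) x = l ('D_v f x).
Proof.
by move=> cl df; rewrite derive_comp ?derive_lin //; exact: linear_differentiable.
Qed.

End Calculus.

(** * Algebra of maps of class C^r *)

Section Cdiff.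
Context {R : realType}.
Implicit Types U V W : normedModType R.

Lemma Cdiff_sub V W r (A B : set V) (f : V -> W) :
  A `<=` B -> Cdiff r B f -> Cdiff r A f.
Proof.
move=> AB; elim: r f => [|r IH] f /=; first by move=> fB x /AB/fB.
by move=> [df Df]; split=> [x /AB/df //|v]; apply: IH.
Qed.

Lemma Cdiff_eq V W r (A : set V) (f g : V -> W) :
  open A -> (forall x, A x -> f x = g x) -> Cdiff r A f -> Cdiff r A g.
Proof.
move=> oA; elim: r f g => [|r IH] f g fg /=.
  move=> fA x Ax; have nfg := open_eq_near oA Ax fg.
  rewrite /prop_for /continuous_at -(fg _ Ax).
  apply: (cvg_trans _ (fA x Ax)); apply: near_eq_cvg.
  exact: nfg.
move=> [df Df]; split=> [x Ax|v].
  by apply: differentiable_near_eq (df x Ax); exact: open_eq_near fg.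
apply: IH (Df v) => x Ax; exact: derive_open_eq fg.
Qed.

Lemma CdiffS V W r (A : set V) (f : V -> W) : Cdiff r.+1 A f -> Cdiff r A f.
Proof.
elim: r f => [|r IH] f /=.
  by move=> [df _] x Ax; exact/differentiable_continuous/df.
by move=> [df Df]; split=> // v; apply: IH; exact: Df.
Qed.

Lemma Cdiff_cst V W r (A : set V) (w : W) : Cdiff r A (fun=> w).
Proof.
elim: r w => [|r IH] w /=; first by move=> x _; exact: cst_continuous.
split=> [x _|v]; first exact: differentiable_cst.
rewrite (_ : 'D_v _ = fun=> 0); first exact: IH.
by apply/funext => x; exact: derive_cst.
Qed.

Lemma Cdiff_lin V W r (A : set V) (l : {linear V -> W}) :
  continuous l -> Cdiff r A l.
Proof.
case: r => [|r] cl /=; first by move=> x _; exact: cl.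
split=> [x _|v]; first exact: linear_differentiable.
rewrite (_ : (fun x => _) = fun=> l v); first exact: Cdiff_cst.
by apply/funext => x; exact: derive_lin.
Qed.

Lemma CdiffD V W r (A : set V) (f g : V -> W) : open A ->
  Cdiff r A f -> Cdiff r A g -> Cdiff r A (fun x => f x + g x).
Proof.
move=> oA; elim: r f g => [|r IH] f g /=.
  by move=> fA gA x Ax; apply: continuousD; [exact: fA|exact: gA].
move=> [df Df] [dg Dg]; split=> [x Ax|v].
  by apply: differentiableD; [exact: df|exact: dg].
apply: Cdiff_eq (IH _ _ (Df v) (Dg v)) => // x Ax.
by rewrite (@deriveD _ _ _ f g) //; apply: diff_derivable; [exact: df|exact: dg].
Qed.

Lemma Cdiff_sum V W r (A : set V) (I : finType) (P : pred I) (f : I -> V -> W) :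
  open A -> (forall i, Cdiff r A (f i)) ->
  Cdiff r A (fun x => \sum_(i | P i) f i x).
Proof.
move=> oA fA; elim: (index_enum I) => [|i s IH].
  by under eq_fun do rewrite big_nil; exact: Cdiff_cst.
under eq_fun do rewrite big_cons; case: (P i) => //.
by apply: CdiffD.
Qed.

Lemma Cdiff_linear_comp U V W r (A : set V) (l : {linear W -> U}) (f : V -> W) :
  open A -> continuous l -> Cdiff r A f -> Cdiff r A (fun x => l (f x)).
Proof.
move=> oA cl; elim: r f => [|r IH] f /=.
  move=> fA x Ax; apply: continuous_comp; [exact: fA|exact: cl].
move=> [df Df]; split=> [x Ax|v].
  apply: differentiable_comp; first exact: df.
  exact: linear_differentiable.
apply: Cdiff_eq (IH _ (Df v)) => // x Ax.
by rewrite derive_linear_comp //; exact: df.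
Qed.

Lemma CdiffM V r (A : set V) (f g : V -> R) : open A ->
  Cdiff r A f -> Cdiff r A g -> Cdiff r A (fun x => f x * g x).
Proof.
move=> oA; elim: r f g => [|r IH] f g.
  by move=> fA gA x Ax; apply: continuousM; [exact: fA|exact: gA].
(* The product rule contains f and g undifferentiated, and the induction hypothesis wants them at
   the lower order. *)
move=> Cf Cg; have Cf' := CdiffS Cf; have Cg' := CdiffS Cg.
move: Cf Cg => /= [df Df] [dg Dg]; split=> [x Ax|v].
  by apply: differentiableM; [exact: df|exact: dg].
apply: Cdiff_eq (CdiffD oA (IH _ _ Cf' (Dg v)) (IH _ _ Cg' (Df v))) => // x Ax.
by rewrite (@deriveM _ _ f g) //; apply: diff_derivable; [exact: df|exact: dg].
Qed.

Lemma CdiffZl V W r (A : set V) (f : V -> R) (w : W) : open A ->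
  Cdiff r A f -> Cdiff r A (fun x => f x *: w).
Proof.
move=> oA; elim: r f => [|r IH] f /=.
  by move=> fA x Ax; apply: continuousZr_tmp; exact: fA.
move=> [df Df]; split=> [x Ax|v].
  by apply: differentiableZl; exact: df.
apply: Cdiff_eq (IH _ (Df v)) => // x Ax.
have d1 := df x Ax.
by rewrite [RHS]deriveE ?diffZl ?deriveE //; exact: differentiableZl.
Qed.

Lemma Cdiff_inv V r (A : set V) (f : V -> R) : open A ->
  (forall x, A x -> f x != 0) -> Cdiff r A f -> Cdiff r A (fun x => (f x)^-1).
Proof.
move=> oA f0; elim: r => [|r IH] .
  by move=> fA x Ax; apply: continuousV; [exact: f0|exact: fA].
move=> Cf; have Cf' := CdiffS Cf.
move: Cf => /= [df Df]; split=> [x Ax|v].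
  by apply: differentiableV; [exact: df|exact: f0].
(* The derivative of 1/f is - (1/f)(1/f) times that of f, and 1/f is of class C^r by induction. *)
have C1 := IH Cf'.
apply: Cdiff_eq (CdiffM oA (CdiffM oA (Cdiff_cst r A (-1 : R)) (CdiffM oA C1 C1)) (Df v)) => // x Ax.
rewrite (@deriveV _ _ f) //; [|exact: f0|by apply: diff_derivable; exact: df].
by rewrite mulN1r -invfM -expr2.
Qed.

End Cdiff.

(** * Chain and product rules in finite dimension *)

Section Finite_coords.
Context {R : realType}.
Implicit Types U V W : normedModType R.

Lemma Cdiff_coords V W (fW : finite_coords W) r (A : set V) (f : V -> W) : open A ->
  (forall l : {linear W -> R}, continuous l -> Cdiff r A (fun x => l (f x))) ->
  Cdiff r A f.
Proof.
case: fW => d [e [c [cc ce]]] oA fl.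
apply: (@Cdiff_eq _ _ _ _ _ (fun x => \sum_i c i (f x) *: e i)) => //.
apply: Cdiff_sum => // i; apply: CdiffZl => //; exact: fl.
Qed.

Lemma CdiffZ V W (fW : finite_coords W) r (A : set V) (s : V -> R) (f : V -> W) :
  open A -> Cdiff r A s -> Cdiff r A f -> Cdiff r A (fun x => s x *: f x).
Proof.
move=> oA Cs Cf; apply: Cdiff_coords => // l cl.
apply: (@Cdiff_eq _ _ _ _ _ (fun x => s x * l (f x))) => // [x Ax|].
  by rewrite linearZ.
by apply: CdiffM => //; exact: Cdiff_linear_comp.
Qed.

(** The derivative of the composite differentiates g along the varying direction ['D_v f x], whereas
    [Cdiff] speaks of fixed directions only. Expanding that direction in a basis gives a sum of
    products, a coordinate of ['D_v f] times a fixed directional derivative of g composed with f, to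
    which the induction hypothesis applies. *)
Lemma Cdiff_comp U V W (fV : finite_coords V) (fW : finite_coords W) r
    (A : set U) (B : set V) (f : U -> V) (g : V -> W) :
  open A -> (forall x, A x -> B (f x)) ->
  Cdiff r A f -> Cdiff r B g -> Cdiff r A (fun x => g (f x)).
Proof.
move=> oA AB; elim: r f g AB => [|r IH] f g AB.
  move=> Cf Cg x Ax; apply: continuous_comp; [exact: Cf|apply: Cg; exact: AB].
move=> Cf Cg; have Cf' := CdiffS Cf; have Cg' := CdiffS Cg.
move: Cf Cg => /= [df Df] [dg Dg]; split=> [x Ax|v].
  by apply: differentiable_comp; [exact: df|apply: dg; exact: AB].
case: fV => d [e [c [cc ce]]].
apply: (@Cdiff_eq _ _ _ _ _ (fun x => \sum_i c i ('D_v f x) *: 'D_(e i) g (f x))) => //.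
  move=> x Ax; have dgf : differentiable g (f x) by apply: dg; exact: AB.
  rewrite (derive_comp _ (df _ Ax) dgf) [in RHS](ce ('D_v f x)) derive_dir_sum //.
  by apply: eq_bigr => i _; rewrite derive_dirZ.
apply: Cdiff_sum => // i; apply: CdiffZ => //; first exact: Cdiff_linear_comp.
exact: (IH f ('D_(e i) g)).
Qed.

Lemma coords_inj V {fV : finite_coords V} (x y : V) :
  (forall l : {linear V -> R}, continuous l -> l x = l y) -> x = y.
Proof.
case: fV => d [e [c [cc ce]]] xy; rewrite (ce x) (ce y).
by apply: eq_bigr => i _; rewrite xy.
Qed.

Lemma differentiable_bigsum V W n (f : 'I_n -> V -> W) x :
  (forall i, differentiable (f i) x) -> differentiable (fun y => \sum_i f i y) x.
Proof.
move=> df; have := differentiable_sum df.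
by rewrite (_ : \sum_i f i = fun y => \sum_i f i y) //; apply/funext => y; rewrite fct_sumE.
Qed.

Lemma derive_bigsum V W n (f : 'I_n -> V -> W) x v :
  (forall i, differentiable (f i) x) ->
  'D_v (fun y => \sum_i f i y) x = \sum_i 'D_v (f i) x.
Proof.
move=> df; rewrite -derive_sum; last by move=> i; exact: diff_derivable.
by congr ('D_v _ x); apply/funext => y; rewrite fct_sumE.
Qed.

Lemma differentiable_scale V W {fW : finite_coords W} (s : V -> R) (f : V -> W) x :
  differentiable s x -> differentiable f x -> differentiable (fun y => s y *: f y) x.
Proof.
move=> ds df; case: fW => d [e [c [cc ce]]].
rewrite (_ : (fun y => _) = fun y => \sum_i (s y * c i (f y)) *: e i); last first.
  apply/funext => y; rewrite [in LHS](ce (f y)) scaler_sumr.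
  by apply: eq_bigr => i _; rewrite scalerA.
apply: differentiable_bigsum => i.
apply: differentiableZl; apply: (@differentiableM _ _ s (fun y => c i (f y))) => //.
by apply: differentiable_comp => //; exact: linear_differentiable.
Qed.

Lemma derive_scale V W {fW : finite_coords W} (s : V -> R) (f : V -> W) x v :
  differentiable s x -> differentiable f x ->
  'D_v (fun y => s y *: f y) x = s x *: 'D_v f x + 'D_v s x *: f x.
Proof.
move=> ds df; apply: coords_inj => l cl.
have dlf : differentiable (fun y => l (f y)) x.
  by apply: differentiable_comp => //; exact: linear_differentiable.
rewrite -derive_linear_comp //; last exact: differentiable_scale.
rewrite (_ : (fun y => _) = (s * (fun y => l (f y)))); last first.
  by apply/funext => y; rewrite linearZ.
rewrite deriveM; [|exact: diff_derivable..].
by rewrite linearD !linearZ /= derive_linear_comp // [l (f x) *: _]mulrC.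
Qed.

End Finite_coords.

(** * Smooth maps *)

Section Smooth.
Context {R : realType}.
Implicit Types U V W : normedModType R.

Lemma smooth_sub V W (A B : set V) (f : V -> W) :
  A `<=` B -> smooth_on B f -> smooth_on A f.
Proof. by move=> AB fB r; exact: Cdiff_sub (fB r). Qed.

Lemma smooth_eq V W (A : set V) (f g : V -> W) :
  open A -> (forall x, A x -> f x = g x) -> smooth_on A f -> smooth_on A g.
Proof. by move=> oA fg fA r; exact: Cdiff_eq (fA r). Qed.

Lemma smooth_differentiable V W (A : set V) (f : V -> W) x :
  smooth_on A f -> A x -> differentiable f x.
Proof. by move=> /(_ 1%N) /= [df _]; exact: df. Qed.

Lemma smooth_continuous V W (A : set V) (f : V -> W) x :
  smooth_on A f -> A x -> {for x, continuous f}.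
Proof. by move=> /(_ 0%N) /=; exact. Qed.

Lemma smooth_derive V W (A : set V) (f : V -> W) v :
  smooth_on A f -> smooth_on A (fun x => 'D_v f x).
Proof. by move=> fA r; case: (fA r.+1) => _; exact. Qed.

Lemma smooth_cst V W (A : set V) (w : W) : smooth_on A (fun=> w).
Proof. by move=> r; exact: Cdiff_cst. Qed.

Lemma smooth_lin V W (A : set V) (l : {linear V -> W}) :
  continuous l -> smooth_on A l.
Proof. by move=> cl r; exact: Cdiff_lin. Qed.

Lemma smoothD V W (A : set V) (f g : V -> W) : open A ->
  smooth_on A f -> smooth_on A g -> smooth_on A (fun x => f x + g x).
Proof. by move=> oA fA gA r; exact: CdiffD. Qed.

Lemma smooth_sum V W (A : set V) (I : finType) (P : pred I) (f : I -> V -> W) :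
  open A -> (forall i, smooth_on A (f i)) ->
  smooth_on A (fun x => \sum_(i | P i) f i x).
Proof. by move=> oA fA r; apply: Cdiff_sum => // i; exact: fA. Qed.

Lemma smoothM V (A : set V) (f g : V -> R) : open A ->
  smooth_on A f -> smooth_on A g -> smooth_on A (fun x => f x * g x).
Proof. by move=> oA fA gA r; exact: CdiffM. Qed.

Lemma smooth_prod V (A : set V) (I : finType) (f : I -> V -> R) :
  open A -> (forall i, smooth_on A (f i)) ->
  smooth_on A (fun x => \prod_i f i x).
Proof.
move=> oA fA; elim: (index_enum I) => [|i s IH].
  by under eq_fun do rewrite big_nil; exact: smooth_cst.
by under eq_fun do rewrite big_cons; exact: smoothM.
Qed.

Lemma smoothV V (A : set V) (f : V -> R) : open A ->
  (forall x, A x -> f x != 0) -> smooth_on A f -> smooth_on A (fun x => (f x)^-1).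
Proof. by move=> oA f0 fA r; exact: Cdiff_inv. Qed.

Lemma smoothZ V W {fW : finite_coords W} (A : set V) (s : V -> R) (f : V -> W) :
  open A -> smooth_on A s -> smooth_on A f -> smooth_on A (fun x => s x *: f x).
Proof. by move=> oA sA fA r; exact: CdiffZ. Qed.

Lemma smoothN V W {fW : finite_coords W} (A : set V) (f : V -> W) :
  open A -> smooth_on A f -> smooth_on A (fun x => - f x).
Proof.
move=> oA fA; under eq_fun do rewrite -scaleN1r; apply: smoothZ => //.
exact: smooth_cst.
Qed.

Lemma smoothB V W {fW : finite_coords W} (A : set V) (f g : V -> W) : open A ->
  smooth_on A f -> smooth_on A g -> smooth_on A (fun x => f x - g x).
Proof. by move=> oA fA gA; apply: smoothD => //; exact: smoothN. Qed.

Lemma smooth_comp U V W {fV : finite_coords V} {fW : finite_coords W}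
    (A : set U) (B : set V) (f : U -> V) (g : V -> W) :
  open A -> (forall x, A x -> B (f x)) ->
  smooth_on A f -> smooth_on B g -> smooth_on A (fun x => g (f x)).
Proof. by move=> oA AB fA gB r; exact: Cdiff_comp (fA r) (gB r). Qed.

Lemma smooth_linear_comp U V W (A : set V) (l : {linear W -> U}) (f : V -> W) :
  open A -> continuous l -> smooth_on A f -> smooth_on A (fun x => l (f x)).
Proof. by move=> oA cl fA r; exact: Cdiff_linear_comp. Qed.

Lemma smooth_rowP V n (A : set V) (f : V -> 'rV[R]_n) : open A ->
  smooth_on A f <-> forall j, smooth_on A (fun x => f x 0 j).
Proof.
move=> oA; split=> [fA j|fA].
  have lin : linear (fun x : 'rV[R]_n => x 0 j : R).
    by move=> a x y; rewrite !mxE.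
  apply: (smooth_linear_comp (l := linear_pack lin)) => //.
  exact: coord_continuous.
apply: (@smooth_eq _ _ _ (fun x => \sum_j f x 0 j *: delta_mx 0 j)) => // [x _|].
  exact/esym/row_sum_delta.
apply: smooth_sum => // j; apply: smoothZ => //; exact: smooth_cst.
Qed.

Lemma smooth_pair U V W {fV : finite_coords V} {fW : finite_coords W}
   (A : set U) (f : U -> V) (g : U -> W) : open A ->
  smooth_on A f -> smooth_on A g -> smooth_on A (fun x => (f x, g x)).
Proof.
move=> oA fA gA.
have lin1 : linear (fun x : V => (x, 0) : V * W).
  by move=> a x y; congr (_, _); rewrite /= ?scaler0 ?addr0.
have lin2 : linear (fun x : W => (0, x) : V * W).
  by move=> a x y; congr (_, _); rewrite /= ?scaler0 ?addr0.
apply: (@smooth_eq _ _ _ (fun x => linear_pack lin1 (f x) + linear_pack lin2 (g x))) => //.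
  by move=> x _; rewrite -[LHS]/(_ + 0, 0 + _) addr0 add0r.
apply: smoothD => //; apply: smooth_linear_comp => // x.
  by apply: cvg_pair; [exact: cvg_id|exact: cvg_cst].
by apply: cvg_pair; [exact: cvg_cst|exact: cvg_id].
Qed.

Lemma smooth_fst V W (A : set (V * W)) : smooth_on A fst.
Proof. by apply: (@smooth_lin _ V A fst) => x; exact: cvg_fst. Qed.

Lemma smooth_snd V W (A : set (V * W)) : smooth_on A snd.
Proof. by apply: (@smooth_lin _ W A snd) => x; exact: cvg_snd. Qed.

Lemma smooth_derive_field V W {fV : finite_coords V} {fW : finite_coords W}
    (A : set V) (f : V -> W) (v : V -> V) :
  open A -> smooth_on A f -> smooth_on A v -> smooth_on A (fun x => 'D_(v x) f x).
Proof.
move=> oA fA vA; case: (fV) => d [e [c [cc ce]]].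
apply: (@smooth_eq _ _ _ (fun x => \sum_i c i (v x) *: 'D_(e i) f x)) => // [x Ax|].
  have df := smooth_differentiable fA Ax.
  rewrite [in RHS](ce (v x)) derive_dir_sum //.
  by apply: eq_bigr => i _; rewrite derive_dirZ.
apply: smooth_sum => // i; apply: smoothZ => //; last exact: smooth_derive.
exact: smooth_linear_comp.
Qed.

(** Product rule for the pairing of the differential of f with the field v: the last term comes from
    the variation of v. *)
Lemma derive_derive_field V W {fV : finite_coords V} {fW : finite_coords W}
    (A : set V) (f : V -> W) (v : V -> V) x w :
  open A -> smooth_on A f -> smooth_on A v -> A x ->
  'D_w (fun x => 'D_(v x) f x) x =
  'D_w (fun y => 'D_(v x) f y) x + 'D_('D_w v x) f x.
Proof.
move=> oA fA vA Ax; case: (fV) => d [e [c [cc ce]]].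
have df y : A y -> differentiable f y by exact: smooth_differentiable.
have dfe i : differentiable (fun x => 'D_(e i) f x) x.
  exact: smooth_differentiable (smooth_derive _ fA) Ax.
have dv : differentiable v x by exact: smooth_differentiable vA Ax.
have dcv i : differentiable (fun x => c i (v x)) x.
  by apply: differentiable_comp => //; exact: linear_differentiable.
have sumE u y : A y -> 'D_u f y = \sum_i c i u *: 'D_(e i) f y.
  move=> Ay; rewrite [in LHS](ce u) derive_dir_sum; last exact: df.
  by apply: eq_bigr => i _; rewrite derive_dirZ //; exact: df.
rewrite (derive_open_eq _ oA Ax (fun y Ay => sumE (v y) y Ay)).
rewrite (derive_open_eq _ oA Ax (fun y Ay => sumE (v x) y Ay)).
rewrite (sumE _ _ Ax) !derive_bigsum -?big_split /=; last first.
  by move=> i; apply: differentiable_scale.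
  by move=> i; apply: differentiable_scale => //; exact: differentiable_cst.
apply: eq_bigr => i _; rewrite derive_scale //.
have dc : differentiable (fun=> c i (v x)) x by exact: differentiable_cst.
rewrite (derive_scale w dc (dfe i)).
by rewrite derive_cst scale0r addr0 derive_linear_comp.
Qed.

Lemma differentiable_fst V W (x : V * W) : differentiable fst x.
Proof. by apply: (@linear_differentiable _ _ _ fst) => y; exact: cvg_fst. Qed.

Lemma differentiable_snd V W (x : V * W) : differentiable snd x.
Proof. by apply: (@linear_differentiable _ _ _ snd) => y; exact: cvg_snd. Qed.

Lemma derive_fst V W (x v : V * W) : 'D_v fst x = v.1.
Proof. by apply: (@derive_lin _ _ _ fst) => y; exact: cvg_fst. Qed.

Lemma derive_snd V W (x v : V * W) : 'D_v snd x = v.2.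
Proof. by apply: (@derive_lin _ _ _ snd) => y; exact: cvg_snd. Qed.

Lemma derive_comp_fst U V W (f : V -> U) (x v : V * W) :
  differentiable f x.1 -> 'D_v (fun y : V * W => f y.1) x = 'D_(v.1) f x.1.
Proof.
move=> df; rewrite (derive_comp (f := fst)) ?derive_fst //.
exact: differentiable_fst.
Qed.

Lemma derive_pair U V W (f : U -> V) (g : U -> W) x v :
  differentiable f x -> differentiable g x ->
  'D_v (fun y => (f y, g y)) x = ('D_v f x, 'D_v g x).
Proof.
move=> df dg; rewrite (deriveE _ (differentiable_pair df dg)).
by rewrite (deriveE _ df) (deriveE _ dg) (congr1 (@^~ v) (diff_pair df dg)).
Qed.

(** * Symmetry of second derivatives *)

Section Schwarz.
Variables (V : normedModType R).

Lemma derive_line (f : V -> R) (x v : V) (s : R) :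
  differentiable f (x + s *: v) ->
  is_derive s 1 (fun s => f (x + s *: v)) ('D_v f (x + s *: v)).
Proof.
move=> df.
have dl : differentiable (fun s : R => x + s *: v) s.
  apply: (@differentiableD _ _ _ (fun=> x) (fun s : R => s *: v)).
    exact: differentiable_cst.
  exact: (@differentiableZl _ _ _ id).
have -> : 'D_v f (x + s *: v) = 'D_1 (fun s : R => f (x + s *: v)) s.
  rewrite [RHS](@derive_comp _ _ _ _ (fun s : R => x + s *: v) f) //; congr ('D_ _ f _).
  rewrite (@deriveD _ _ _ (fun=> x) (fun s : R => s *: v)); last first.
    by apply: diff_derivable; exact: (@differentiableZl _ _ _ id).
    exact: derivable_cst.
  rewrite derive_cst add0r deriveE; last exact: (@differentiableZl _ _ _ id).
  rewrite (@diffZl _ _ _ id) //.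
  by rewrite -deriveE // derive_id scale1r.
apply: derivableP; apply: diff_derivable.
exact: (@differentiable_comp _ _ _ _ (fun s : R => x + s *: v) f).
Qed.

(* Two applications of the mean value theorem; the left-hand side is symmetric
   in v and w, whence the symmetry of second derivatives. *)
Lemma second_difference (A : set V) (f : V -> R) (x v w : V) :
  open A -> A x -> (forall y, A y -> differentiable f y) ->
  (forall y, A y -> differentiable ('D_v f) y) ->
  forall P : set V, nbhs x P -> exists2 d : R, 0 < d & forall h : R, 0 < h < d ->
    exists2 y, P y & f (x + h *: w + h *: v) - f (x + h *: v) -
      (f (x + h *: w) - f x) = h * h * 'D_w ('D_v f) y.
Proof.
move=> oA Ax df dDf P Px.
have /nbhs_ballP[e /= e0 ePA] : nbhs x (P `&` A).
  by apply: filterI => //; exact: open_near.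
(* h N bounds the displacement from x of every point of the parallelogram; the summand 1 keeps N
   positive when v and w are zero. *)
pose N := `|v| + `|w| + 1.
have N0 : 0 < N by rewrite /N ltr_wpDl // addr_ge0.
exists (e / N); first by rewrite divr_gt0.
move=> h /andP[h0 hd].
have inP s t : 0 <= s <= h -> 0 <= t <= h -> (P `&` A) (x + s *: v + t *: w).
  move=> /andP[s0 sh] /andP[t0 th]; apply: ePA.
  rewrite -ball_normE /= -addrA opprD addNKr normrN.
  apply: (le_lt_trans (ler_normD _ _)); rewrite !normrZ (ger0_norm s0) (ger0_norm t0).
  apply: (@le_lt_trans _ _ (h * N)).
    rewrite /N mulrDr mulr1 mulrDr -[leLHS]addr0 !lerD ?ler_wpM2r //.
    exact: ltW.
  by rewrite -ltr_pdivlMr.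
have inP' s t : 0 <= s <= h -> 0 <= t <= h -> A (x + t *: w + s *: v).
  by move=> sh th; rewrite addrAC; case: (inP s t).
have hh : 0 <= h <= h by rewrite lexx ltW.
have zh : 0 <= (0 : R) <= h by rewrite lexx ltW.
(* The second difference is the increment over [0, h] of [phi], itself a difference over the step h
   w. The mean value theorem along v turns it into a difference of ['D_v f] over that step, and the
   one along w finishes. *)
pose phi (s : R) := f (x + h *: w + s *: v) - f (x + s *: v).
pose dphi (s : R) := 'D_v f (x + h *: w + s *: v) - 'D_v f (x + s *: v).
have phiP s : 0 <= s <= h -> is_derive s 1 phi (dphi s).
  move=> sh; apply: is_deriveB; apply: derive_line; apply: df; first exact: inP'.
  by have := inP' _ _ sh zh; rewrite scale0r addr0.
have [s1 s1h phiE] : exists2 c, c \in `[0, h] & phi h - phi 0 = dphi c * (h - 0).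
  apply: MVT_segment => [|s|]; first exact: ltW.
    by rewrite in_itv /= => /andP[s0 sh]; apply: phiP; rewrite !ltW.
  apply: derivable_within_continuous => s; rewrite in_itv /= => sh.
  by have [] := phiP _ sh.
rewrite in_itv /= in s1h.
pose psi (t : R) := 'D_v f (x + s1 *: v + t *: w).
pose dpsi (t : R) := 'D_w ('D_v f) (x + s1 *: v + t *: w).
have psiP t : 0 <= t <= h -> is_derive t 1 psi (dpsi t).
  move=> th; apply: (derive_line (f := 'D_v f)); apply: dDf.
  by case: (inP _ _ s1h th).
have [t1 t1h psiE] : exists2 c, c \in `[0, h] & psi h - psi 0 = dpsi c * (h - 0).
  apply: MVT_segment => [|s|]; first exact: ltW.
    by rewrite in_itv /= => /andP[s0 sh]; apply: psiP; rewrite !ltW.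
  apply: derivable_within_continuous => s; rewrite in_itv /= => sh.
  by have [] := psiP _ sh.
rewrite in_itv /= in t1h.
exists (x + s1 *: v + t1 *: w); first by case: (inP _ _ s1h t1h).
have := phiE; rewrite /phi /dphi !scale0r !addr0 => ->.
have := psiE; rewrite /psi /dpsi !scale0r !addr0 [x + _ + _ *: w]addrAC => ->.
by rewrite !subr0 mulrAC -mulrA mulrC.
Qed.

(** One second difference, divided by h^2, is a value of each mixed derivative at some point near x;
    continuity of both at x forces them to agree there. *)
Lemma schwarz_real (A : set V) (f : V -> R) (x v w : V) :
  open A -> smooth_on A f -> A x -> 'D_v ('D_w f) x = 'D_w ('D_v f) x.
Proof.
move=> oA fA Ax.
have df u y : A y -> differentiable ('D_u f) y.
  exact/smooth_differentiable/smooth_derive.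
have cD u u' : {for x, continuous ('D_u' ('D_u f))}.
  by apply: smooth_continuous Ax; do 2!apply: smooth_derive.
apply/eqP; rewrite -subr_eq0 -normr_eq0; apply: contraT => ne.
(* Half the supposed gap: two values within e of a common number differ by less than the gap. *)
have e0 : 0 < `|'D_v ('D_w f) x - 'D_w ('D_v f) x| / 2 by rewrite divr_gt0 // lt0r ne /=.
set e := _ / 2 in e0.
have nb u u' : nbhs x [set y | `|'D_u' ('D_u f) x - 'D_u' ('D_u f) y| < e].
  by have /cvgrPdist_lt/(_ _ e0) := cD u u'.
have df0 y : A y -> differentiable f y by exact: smooth_differentiable.
have [d1 d10 H1] := second_difference w oA Ax df0 (df v) (nb v w).
have [d2 d20 H2] := second_difference v oA Ax df0 (df w) (nb w v).
(* A single step length admissible for both orders of v and w. *)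
pose h := Num.min d1 d2 / 2.
have m0 : 0 < Num.min d1 d2 by rewrite lt_min d10.
have h0 : 0 < h by rewrite divr_gt0.
have hm : h < Num.min d1 d2 by rewrite ltr_pdivrMr // ltr_pMr // ltr1n.
move: (hm); rewrite lt_min => /andP[hd1 hd2].
have [y /= Py E1] := H1 h (introT andP (conj h0 hd1)).
have [z /= Pz E2] := H2 h (introT andP (conj h0 hd2)).
have yz : 'D_w ('D_v f) y = 'D_v ('D_w f) z.
  apply: (@mulfI _ (h * h)); first by rewrite mulf_neq0 // gt_eqF.
  have swap (a b c d : R) : a - b - (c - d) = a - c - (b - d).
    by rewrite !opprB addrACA [RHS]addrACA [- c - b]addrC.
  have xvw : x + h *: v + h *: w = x + h *: w + h *: v by exact: addrAC.
  rewrite xvw in E2; exact: etrans (esym E1) (etrans (swap _ _ _ _) E2).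
move: Py Pz; rewrite yz => Py Pz.
have tri (a b c r : R) : `|a - c| < r -> `|b - c| < r -> `|a - b| < r + r.
  move=> ac bc; rewrite -(subrKA c); apply: (le_lt_trans (ler_normD _ _)).
  by rewrite [`|c - b|]distrC ltrD.
have := tri _ _ _ _ Pz Py.
by rewrite /e -splitr ltxx.
Qed.

Lemma schwarz (W : normedModType R) {fW : finite_coords W} (A : set V) (f : V -> W) (x v w : V) :
  open A -> smooth_on A f -> A x -> 'D_v ('D_w f) x = 'D_w ('D_v f) x.
Proof.
move=> oA fA Ax; apply: coords_inj => l cl.
have lfA : smooth_on A (fun x => l (f x)) by exact: smooth_linear_comp.
have E u u' : l ('D_u ('D_u' f) x) = 'D_u ('D_u' (fun x => l (f x))) x.
  rewrite -derive_linear_comp //; last first.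
    exact: smooth_differentiable (smooth_derive _ fA) Ax.
  apply: derive_open_eq oA Ax _ => y Ay; rewrite derive_linear_comp //.
  exact: smooth_differentiable Ay.
by rewrite !E; exact: schwarz_real lfA Ax.
Qed.

End Schwarz.

End Smooth.

(** * Frames and Euler-Lagrange equations in a chart *)

Section Smooth_matrix.
Context {R : realType} {V : normedModType R} (A : set V) (oA : open A).

Lemma smooth_entry n (f : V -> 'rV[R]_n) i j :
  smooth_on A f -> smooth_on A (fun x => f x i j).
Proof. by rewrite ord1 => /(smooth_rowP _ oA). Qed.

Lemma smooth_det n (M : V -> 'M[R]_n) :
  (forall i j, smooth_on A (fun x => M x i j)) -> smooth_on A (fun x => \det (M x)).
Proof.
move=> sM; rewrite /determinant; apply: smooth_sum => // s.
apply: smoothM => //; first exact: smooth_cst.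
by apply: smooth_prod => // i; exact: sM.
Qed.

Lemma smooth_invmx n (M : V -> 'M[R]_n) i j :
  (forall i j, smooth_on A (fun x => M x i j)) -> (forall x, A x -> M x \in unitmx) ->
  smooth_on A (fun x => invmx (M x) i j).
Proof.
move=> sM uM.
(* Cramer's rule: the (i, j) entry of the inverse is the (j, i) cofactor over the determinant. *)
apply: (@smooth_eq _ _ _ _ (fun x => (\det (M x))^-1 *
    ((-1) ^+ (j + i) * \det (row' j (col' i (M x)))))) => // [x Ax|].
  by rewrite /invmx uM // !mxE.
apply: smoothM => //.
  apply: smoothV => //; last exact: smooth_det.
  by move=> x /uM; rewrite unitmxE unitfE.
apply: smoothM => //; first exact: smooth_cst.
apply: smooth_det => i' j'.
by under eq_fun do rewrite !mxE; exact: sM.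
Qed.

Lemma smooth_mulmx m n p (M : V -> 'M[R]_(m, n)) (N : V -> 'M[R]_(n, p)) i j :
  (forall i j, smooth_on A (fun x => M x i j)) ->
  (forall i j, smooth_on A (fun x => N x i j)) ->
  smooth_on A (fun x => (M x *m N x) i j).
Proof.
move=> sM sN; under eq_fun do rewrite mxE.
by apply: smooth_sum => // l; apply: smoothM; [|exact: sM|exact: sN].
Qed.

End Smooth_matrix.

Section Coord.
Context {R : realType} (n : nat) (t : n.-tuple 'rV[R]_n) (bt : basis_of fullv t).

Definition basis_mx := \matrix_(i, j) tnth t i 0 j.

Lemma coord_sum (w : 'rV[R]_n) : w = \sum_i coord t i w *: tnth t i.
Proof.
rewrite [LHS](coord_basis bt (memvf w)); apply: eq_bigr => i _.
by rewrite (tnth_nth 0).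
Qed.

Lemma coord_tnth i j : coord t i (tnth t j) = (i == j)%:R.
Proof. by rewrite (tnth_nth 0) coord_free ?(basis_free bt) // eq_sym. Qed.

Lemma mul_basis_mx (c : 'rV[R]_n) : c *m basis_mx = \sum_i c 0 i *: tnth t i.
Proof.
rewrite mulmx_sum_row; apply: eq_bigr => i _; congr (_ *: _).
by apply/rowP => j; rewrite !mxE.
Qed.

Lemma basis_mx_unit : basis_mx \in unitmx.
Proof.
(* Row j holds the coordinates of the j-th standard vector in the basis t, so this is the inverse
   matrix. *)
pose C := \matrix_(j, i) coord t i (delta_mx 0 j : 'rV[R]_n).
suff : C *m basis_mx = 1%:M by case/mulmx1_unit.
apply/row_matrixP => j; rewrite row_mul mul_basis_mx row1.
rewrite [RHS](coord_sum (delta_mx 0 j)).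
by apply: eq_bigr => i _; rewrite !mxE.
Qed.

(** The matrix form shows that the coordinates vary smoothly when the basis does. *)
Lemma coord_invmx i (w : 'rV[R]_n) : coord t i w = (w *m invmx basis_mx) 0 i.
Proof.
rewrite [in RHS](coord_sum w).
have -> : \sum_i coord t i w *: tnth t i = (\row_i coord t i w) *m basis_mx.
  by rewrite mul_basis_mx; apply: eq_bigr => j _; rewrite mxE.
by rewrite mulmxK ?basis_mx_unit // mxE.
Qed.

End Coord.

Lemma derive_linear (R : realType) (V W : normedModType R) (l : {linear V -> W}) x v :
  'D_v l x = l v.
Proof.
apply/lim_near_cst => //=; near=> h.
rewrite (linearP l) addrK scalerA mulVf ?scale1r //.
by near: h; exact: nbhs_dnbhs_neq.
Unshelve. all: by end_near. Qed.

(** * Lifts, Hessian and Euler-Lagrange equations of a frame on an open set of R^n *)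

Section Local.
Context {R : realType} (n : nat).
Local Notation V := 'rV[R]_n.

Variables (U : set V) (f : 'I_n -> V -> V).
Hypothesis oU : open U.
Hypothesis sf : forall i, smooth_on U (f i).
Hypothesis bf : forall x, U x -> basis_of fullv [tuple f i x | i < n].

Definition local_tangent : set (V * V) := [set y | U y.1].
Local Notation O := local_tangent.

Definition local_velocity i (y : V * V) : R := coord [tuple f i y.1 | i < n] i y.2.
Local Notation v := local_velocity.

Definition local_vertical i (F : V * V -> R) (y : V * V) : R :=
  'D_((0, f i y.1) : V * V) F y.
Local Notation Vd := local_vertical.

Definition local_complete i (F : V * V -> R) (y : V * V) : R :=
  'D_((f i y.1, 'D_(y.2) (f i) y.1) : V * V) F y.
Local Notation Cd := local_complete.

Definition local_hessian (F : V * V -> R) (y : V * V) : 'M[R]_n :=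
  \matrix_(i, j) 'D_((0, delta_mx 0 i) : V * V)
    (fun y => 'D_((0, delta_mx 0 j) : V * V) F y) y.

(** The part dF/dq^j - u^i d^2F/dq^i du^j of the Euler-Lagrange equations that is free of
    accelerations. With b the acceleration and H the velocity Hessian, the equations become b H =
    force. *)
Definition local_force (F : V * V -> R) (y : V * V) : V :=
  \row_j ('D_((delta_mx 0 j, 0) : V * V) F y -
          'D_((y.2, 0) : V * V) (fun y => 'D_((0, delta_mx 0 j) : V * V) F y) y).

Lemma open_local_tangent : open O.
Proof. by apply: open_comp => // y _; exact: cvg_fst. Qed.

Lemma smooth_comp_fst (W : normedModType R) {fW : finite_coords W} (A : set (V * V)) (g : V -> W) :
  open A -> A `<=` O -> smooth_on U g -> smooth_on A (fun y => g y.1).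
Proof.
move=> oA AO sg; apply: (smooth_comp (B := U) (f := fst)) => //.
exact: smooth_fst.
Qed.

Lemma smooth_velocity i : smooth_on O (v i).
Proof.
have oO := open_local_tangent.
apply: (@smooth_eq _ _ _ _ (fun y => (y.2 *m invmx (basis_mx [tuple f i y.1 | i < n])) 0 i)).
- exact: oO.
- by move=> y Oy; rewrite /v coord_invmx //; exact: bf.
- apply: smooth_mulmx => // [i' j|i' j].
    by apply: smooth_entry => //; exact: smooth_snd.
  apply: smooth_invmx => // [i1 j1|y Oy]; last by apply: basis_mx_unit; exact: bf.
  under eq_fun do rewrite mxE tnth_mktuple.
  by apply: smooth_entry => //; exact: smooth_comp_fst.
Qed.

Lemma velocity_sum y : O y -> y.2 = \sum_i v i y *: f i y.1.
Proof.
move=> Oy; rewrite [LHS](coord_sum (bf Oy)).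
by apply: eq_bigr => i _; rewrite tnth_mktuple.
Qed.

(** Quasi-velocities are linear on each fibre, so a fibre derivative returns the same coordinate
    functional. *)
Lemma derive_velocity i a y : O y ->
  'D_((0, a) : V * V) (v i) y = coord [tuple f i y.1 | i < n] i a.
Proof.
case: y => x w Oy.
have dw : differentiable (fun w' : V => (x, w')) w.
  by apply: differentiable_pair; [exact: differentiable_cst|].
have dv : differentiable (v i) (x, w) by exact: smooth_differentiable (smooth_velocity i) Oy.
have dE : 'D_a (fun w' : V => (x, w')) w = (0, a).
  have dc : differentiable (fun=> x) w by exact: differentiable_cst.
  have di : differentiable id w by [].
  by rewrite (derive_pair a dc di) derive_cst derive_id.
by have := derive_comp a dw dv; rewrite dE => <-; rewrite -[LHS]/('D_a (coord [tuple f i x | i < n] i) w) derive_linear.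
Qed.

Lemma vertical_velocity i j y : O y -> Vd i (v j) y = (j == i)%:R.
Proof.
move=> Oy; rewrite /Vd derive_velocity //.
rewrite -[f i y.1](tnth_mktuple (fun i => f i y.1)) coord_tnth //; exact: bf.
Qed.

Lemma smooth_lift (A : set (V * V)) i : open A -> A `<=` O ->
  smooth_on A (fun y => (0, f i y.1) : V * V).
Proof.
move=> oA AO; apply: smooth_pair => //; first exact: smooth_cst.
exact: smooth_comp_fst.
Qed.

Lemma smooth_vertical (A : set (V * V)) i (F : V * V -> R) : open A -> A `<=` O ->
  smooth_on A F -> smooth_on A (Vd i F).
Proof. by move=> oA AO sF; apply: smooth_derive_field => //; exact: smooth_lift. Qed.

(** The coefficients of a vertical lift depend on the base point alone, and a vertical derivative
    does not move the base point; the inner direction may be frozen. *)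
Lemma vertical_vertical (A : set (V * V)) i j (F : V * V -> R) y : open A -> A `<=` O ->
  smooth_on A F -> A y ->
  Vd i (Vd j F) y = 'D_((0, f i y.1) : V * V) (fun y' => 'D_((0, f j y.1) : V * V) F y') y.
Proof.
move=> oA AO sF Ay; rewrite /Vd (derive_derive_field _ oA sF (smooth_lift j oA AO) Ay).
rewrite derive_pair ?derive_cst; last 2 first.
  exact: differentiable_cst.
  by apply: smooth_differentiable (Ay); apply: smooth_comp_fst.
rewrite (derive_comp_fst _ (smooth_differentiable (sf j) (AO _ Ay))) /=.
by rewrite !derive0 addr0.
Qed.

Lemma derive_sum_velocity p (s : 'I_p -> 'I_n) (g : 'I_p -> V * V -> R) a y :
  (forall i, smooth_on O (g i)) -> O y ->
  'D_a (fun y => \sum_i g i y * v (s i) y) y =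
  \sum_i ('D_a (g i) y * v (s i) y + g i y * 'D_a (v (s i)) y).
Proof.
move=> sg Oy; have dg i := smooth_differentiable (sg i) Oy.
have dv i := smooth_differentiable (smooth_velocity i) Oy.
rewrite derive_bigsum; last by move=> i; exact: (@differentiableM _ _ (g i) (v (s i))).
apply: eq_bigr => i _.
rewrite (@deriveM _ _ (g i) (v (s i))); [|exact: diff_derivable..].
by rewrite addrC [in RHS]mulrC.
Qed.

Lemma pair_sum (I : finType) (F G : I -> V) :
  \sum_i (F i, G i) = (\sum_i F i, \sum_i G i) :> V * V.
Proof. by elim/big_rec3: _ => [|i ? ? ? _ ->]. Qed.

Lemma vertical_row_sum (c : V) :
  ((0, c) : V * V) = \sum_i c 0 i *: ((0, delta_mx 0 i) : V * V).
Proof.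
have -> : \sum_i c 0 i *: ((0, delta_mx 0 i) : V * V) =
    \sum_i ((0, c 0 i *: delta_mx 0 i) : V * V).
  by apply: eq_bigr => i _; congr (_, _); rewrite /= scaler0.
by rewrite pair_sum big1 // -row_sum_delta.
Qed.

Lemma horizontal_row_sum (c : V) :
  ((c, 0) : V * V) = \sum_i c 0 i *: ((delta_mx 0 i, 0) : V * V).
Proof.
have -> : \sum_i c 0 i *: ((delta_mx 0 i, 0) : V * V) =
    \sum_i ((c 0 i *: delta_mx 0 i, 0) : V * V).
  by apply: eq_bigr => i _; congr (_, _); rewrite /= scaler0.
by rewrite pair_sum -row_sum_delta big1.
Qed.

Lemma vertical_dirE (A : set (V * V)) (F : V * V -> R) y b : smooth_on A F -> A y ->
  'D_((0, b) : V * V) F y = \sum_j b 0 j *: 'D_((0, delta_mx 0 j) : V * V) F y.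
Proof.
move=> sF Ay; have dF := smooth_differentiable sF Ay.
rewrite vertical_row_sum derive_dir_sum //.
by apply: eq_bigr => j _; rewrite derive_dirZ.
Qed.

Lemma derive_vertical_dir (A : set (V * V)) (F : V * V -> R) y b a : open A -> smooth_on A F -> A y ->
  'D_a (fun y => 'D_((0, b) : V * V) F y) y =
  \sum_j b 0 j *: 'D_a (fun y => 'D_((0, delta_mx 0 j) : V * V) F y) y.
Proof.
move=> oA sF Ay; have dDF j := smooth_differentiable (smooth_derive (0, delta_mx 0 j) sF) Ay.
rewrite (derive_open_eq _ oA Ay (fun y Ay => vertical_dirE b sF Ay)).
rewrite derive_bigsum; last first.
  by move=> j; apply: differentiable_scale => //; exact: differentiable_cst.
apply: eq_bigr => j _.
by rewrite (@deriveZ _ _ _ (fun y' => 'D_((0, delta_mx 0 j) : V * V) F y')) //; exact: diff_derivable.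
Qed.

Lemma local_hessianE (A : set (V * V)) (F : V * V -> R) y a b : open A -> smooth_on A F -> A y ->
  'D_((0, a) : V * V) (fun y => 'D_((0, b) : V * V) F y) y =
  (a *m local_hessian F y *m b^T) 0 0.
Proof.
move=> oA sF Ay.
rewrite (derive_vertical_dir _ _ oA sF Ay) mxE; apply: eq_bigr => j _.
rewrite (vertical_dirE _ (smooth_derive _ sF) Ay) !mxE mulrC; congr (_ * _).
by apply: eq_bigr => i _; rewrite !mxE.
Qed.

Lemma local_force_dir (A : set (V * V)) (F : V * V -> R) y a : open A -> smooth_on A F -> A y ->
  'D_((a, 0) : V * V) F y - 'D_((y.2, 0) : V * V) (fun y => 'D_((0, a) : V * V) F y) y
  = (local_force F y *m a^T) 0 0.
Proof.
move=> oA sF Ay; have dF := smooth_differentiable sF Ay.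
rewrite (derive_vertical_dir _ _ oA sF Ay) horizontal_row_sum derive_dir_sum // -sumrB mxE.
by apply: eq_bigr => j _; rewrite derive_dirZ // -scalerBr !mxE mulrC.
Qed.

Lemma pairE (a b : V) : ((a, b) : V * V) = (a, 0) + (0, b).
Proof. by rewrite -[RHS]/(a + 0, 0 + b) addr0 add0r. Qed.

(* The left-hand side is linear in the value of the frame field f i, the
   derivatives of f i along the curve cancelling between the two terms. *)
Lemma euler_lagrange_eq (A : set (V * V)) (F : V * V -> R) y i b : open A -> A `<=` O ->
  smooth_on A F -> A y ->
  'D_((y.2, b) : V * V) (Vd i F) y - Cd i F y =
  ((b *m local_hessian F y - local_force F y) *m (f i y.1)^T) 0 0.
Proof.
move=> oA AO sF Ay; have dF := smooth_differentiable sF Ay.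
have dDF c := smooth_differentiable (smooth_derive c sF) Ay.
rewrite /Vd (derive_derive_field _ oA sF (smooth_lift i oA AO) Ay).
have -> : 'D_((y.2, b) : V * V) (fun y => (0, f i y.1) : V * V) y = (0, 'D_(y.2) (f i) y.1).
  rewrite (derive_pair (f := fun=> 0) (g := fun y => f i y.1)) ?derive_cst.
  - by rewrite (derive_comp_fst _ (smooth_differentiable (sf i) (AO _ Ay))).
  - exact: differentiable_cst.
  - by apply: smooth_differentiable (Ay); exact: smooth_comp_fst.
rewrite /Cd [(f i y.1, _)]pairE derive_dirD // opprD addrACA subrr addr0.
rewrite [(y.2, b)]pairE derive_dirD //.
rewrite (local_hessianE _ _ oA sF Ay) mulmxBl [in RHS]mxE [X in _ = _ + X]mxE.
by rewrite -(local_force_dir _ oA sF Ay) opprB -addrA addrCA.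
Qed.

(** Each equation pairs one and the same row vector with a frame field. The frame being a basis, all
    pairings vanish exactly when the vector does, and the frame disappears from the right-hand
    side. *)
Lemma euler_lagrange_iff (A : set (V * V)) (F : V * V -> R) y b : open A -> A `<=` O ->
  smooth_on A F -> A y ->
  (forall i, 'D_((y.2, b) : V * V) (Vd i F) y - Cd i F y = 0) <->
  b *m local_hessian F y = local_force F y.
Proof.
move=> oA AO sF Ay; split=> [E|E i]; last first.
  by rewrite (euler_lagrange_eq _ _ oA AO sF Ay) E subrr mul0mx mxE.
apply/eqP; rewrite -subr_eq0; apply/eqP.
set e := _ - _.
have eP i : e *m (f i y.1)^T = 0.
  apply/rowP => j; rewrite ord1 [RHS]mxE.
  by rewrite -(euler_lagrange_eq _ _ oA AO sF Ay) E.
clearbody e; have bu := basis_mx_unit (bf (AO _ Ay)).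
have bt : (basis_mx [tuple f i y.1 | i < n])^T \in unitmx by rewrite unitmx_tr.
rewrite -[e](mulmxK bt); suff -> : e *m (basis_mx [tuple f i y.1 | i < n])^T = 0.
  by rewrite mul0mx.
apply/rowP => i; rewrite [RHS]mxE.
have := congr1 (fun M : 'M[R]_1 => M 0 0) (eP i).
rewrite !mxE => E0; apply: etrans E0.
by apply: eq_bigr => j _; rewrite !mxE tnth_mktuple.
Qed.

Lemma smooth_hessian_entry (A : set (V * V)) (F : V * V -> R) i j : smooth_on A F ->
  smooth_on A (fun y => local_hessian F y i j).
Proof.
move=> sF; under eq_fun do rewrite mxE; do 2!apply: smooth_derive; exact: sF.
Qed.

(** The second component is the solution b of b H = force; Cramer's rule keeps it smooth. *)
Lemma smooth_euler_lagrange (A : set (V * V)) (F : V * V -> R) : open A -> smooth_on A F ->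
  (forall y, A y -> local_hessian F y \in unitmx) ->
  smooth_on A (fun y => (y.2, local_force F y *m invmx (local_hessian F y))).
Proof.
move=> oA sF uH; apply: smooth_pair => //; first exact: smooth_snd.
apply/smooth_rowP => // j; apply: smooth_mulmx => // [i' j'|i' j'].
  under eq_fun do rewrite mxE; apply: smoothB => //; first exact: smooth_derive.
  apply: (smooth_derive_field (v := fun y => (y.2, 0))) => //; first exact: smooth_derive.
  apply: smooth_pair => //; [exact: smooth_snd|exact: smooth_cst].
by apply: smooth_invmx => // i1 j1; exact: smooth_hessian_entry.
Qed.

End Local.

(** * The function L - p_a v^a in coordinates *)

Section Local_Ltilde.
Context {R : realType} (m k : nat).
Local Notation n := (m + k)%N.
Local Notation V := 'rV[R]_n.
Variables (U : set V) (f : 'I_n -> V -> V) (l : V * V -> R).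
Hypothesis oU : open U.
Hypothesis sf : forall i, smooth_on U (f i).
Hypothesis bf : forall x, U x -> basis_of fullv [tuple f i x | i < n].
Local Notation O := (local_tangent U).
Hypothesis sl : smooth_on O l.
Local Notation v := (local_velocity f).
Local Notation Vd := (local_vertical f).
Local Notation va a := (v (rshift m a)).
Local Notation Va a := (Vd (rshift m a)).
Local Notation g := (fun (a b : 'I_k) y => Va a (Va b l) y).

Definition local_Ltilde (y : V * V) : R :=
  l y - \sum_(a < k) Va a l y * va a y.
Local Notation lt := local_Ltilde.

Let oO : open O := open_local_tangent oU.
Let OO : O `<=` O. Proof. by []. Qed.

Let sV i : smooth_on O (Vd i l).
Proof. by have := smooth_vertical sf i oO OO; apply. Qed.

Let sVV i j : smooth_on O (Vd i (Vd j l)).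
Proof. by have := smooth_vertical sf i oO OO; apply. Qed.

Let sv i : smooth_on O (v i).
Proof. have := smooth_velocity oU sf bf i. by apply. Qed.

Lemma smooth_local_Ltilde : smooth_on O lt.
Proof.
apply: smoothB => //; apply: smooth_sum => // a; exact: smoothM.
Qed.

Lemma vertical_local_Ltilde i y : O y ->
  Vd i lt y = Vd i l y - \sum_a Vd i (Va a l) y * va a y -
              \sum_a Va a l y * (rshift m a == i)%:R.
Proof.
move=> Oy.
have sS : smooth_on O (fun y => \sum_(a < k) Va a l y * va a y).
  apply: smooth_sum => // a; exact: smoothM.
have dl := smooth_differentiable sl Oy.
have dS := smooth_differentiable sS Oy.
rewrite /Vd (@deriveB _ _ _ l (fun y => \sum_(a < k) Va a l y * va a y));
  [|exact: diff_derivable..].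
rewrite (derive_sum_velocity oU sf bf (fun a : 'I_k => rshift m a) (g := fun a => Va a l)) //.
rewrite big_split /= opprD addrA; congr (_ - _ - _).
by apply: eq_bigr => a _; rewrite -(vertical_velocity oU sf bf _ _ Oy).
Qed.

(* Both the regularity near C and the tangency to C are consequences of this
   identity. *)
Lemma vertical_b_local_Ltilde b y : O y ->
  Va b lt y = - \sum_a g b a y * va a y.
Proof.
move=> Oy; rewrite vertical_local_Ltilde // [X in _ - X](bigD1 b) //= eqxx mulr1.
rewrite [X in _ - (_ + X)]big1 ?addr0; last first.
  by move=> a ab; rewrite eq_rshift (negbTE ab) mulr0.
by rewrite addrAC subrr add0r.
Qed.

Lemma vertical_al_local_Ltilde al y : O y ->
  Vd (lshift k al) lt y = Vd (lshift k al) l y -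
    \sum_a Vd (lshift k al) (Va a l) y * va a y.
Proof.
move=> Oy; rewrite vertical_local_Ltilde // [X in _ - _ - X]big1 ?subr0 // => a _.
by rewrite eq_rlshift mulr0.
Qed.

(** Where the v^b vanish, the terms that contain derivatives of the coefficients drop out; hence no
    third derivative of L enters on C. *)
Lemma derive_sum_velocity0 (h : 'I_k -> V * V -> R) a y : O y ->
  (forall b, smooth_on O (h b)) -> (forall b, va b y = 0) ->
  'D_a (fun y => \sum_b h b y * va b y) y = \sum_b h b y * 'D_a (va b) y.
Proof.
move=> Oy sh v0; rewrite (derive_sum_velocity oU sf bf) //.
by apply: eq_bigr => b _; rewrite v0 mulr0 add0r.
Qed.

Section At.
Variable y : V * V.
Hypothesis Oy : O y.
Hypothesis v0 : forall a, va a y = 0.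
Hypothesis ug : (\matrix_(a, b) g a b y) \in unitmx.

(** Applied with vertical a it gives two blocks of the Hessian, with a = (u, b) along the
    Euler-Lagrange field the tangency. *)
Lemma derive_vertical_b_Ltilde b a :
  'D_a (Va b lt) y = - \sum_c g b c y * 'D_a (va c) y.
Proof.
rewrite (derive_open_eq _ oO Oy (vertical_b_local_Ltilde b)).
have sg c : smooth_on O (Va b (Va c l)) by exact: sVV.
have sS : smooth_on O (fun y => \sum_c g b c y * va c y).
  apply: smooth_sum => // c; exact: smoothM.
have dS := smooth_differentiable sS Oy.
rewrite (@deriveN _ _ _ (fun y => \sum_c g b c y * va c y)); last exact: diff_derivable.
by rewrite (derive_sum_velocity0 _ Oy sg v0).
Qed.

Lemma hessian_local_Ltilde_unit :
  (\matrix_(al < m, be < m) Vd (lshift k al) (Vd (lshift k be) l) y) \in unitmx ->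
  local_hessian lt y \in unitmx.
Proof.
move=> uD.
set gD := (\matrix_(al < m, be < m) _) in uD.
have ug' := ug; set gG := (\matrix_(a < k, b < k) _) in ug'.
(* Congruence by [P] replaces the coordinate Hessian by the matrix of second vertical derivatives
   along the frame, and does not affect invertibility. *)
pose P := basis_mx [tuple f i y.1 | i < n].
(* Block triangular because d v^a (X_al^V) = 0 and v^a = 0 at y. *)
have GE : P *m local_hessian lt y *m P^T = block_mx gD 0
    (\matrix_(a, be) Vd (rshift m a) (Vd (lshift k be) lt) y) (- gG^T).
  have E i j : (P *m local_hessian lt y *m P^T) i j = Vd i (Vd j lt) y.
    rewrite (vertical_vertical sf _ _ oO OO smooth_local_Ltilde Oy).
    rewrite (local_hessianE _ _ oO smooth_local_Ltilde Oy).
    have rE i' : f i' y.1 = row i' P.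
      by apply/rowP => j'; rewrite !mxE tnth_mktuple.
    rewrite !rE mxE [in RHS]mxE; apply: eq_bigr => c _.
    rewrite -row_mul; congr (_ * _); first by rewrite [RHS]mxE.
    by rewrite [LHS]mxE [RHS]mxE [RHS]mxE.
  apply/matrixP => i j; rewrite E.
  rewrite -[i](splitK i) -[j](splitK j).
  case: (fintype.split i) => i'; case: (fintype.split j) => j' /=.
  - rewrite block_mxEul mxE.
    have sS : smooth_on O (fun y => \sum_c Vd (lshift k j') (Va c l) y * va c y).
      by apply: smooth_sum => // c; exact: smoothM.
    have dS := smooth_differentiable sS Oy.
    have dV := smooth_differentiable (sV (lshift k j')) Oy.
    rewrite /Vd (derive_open_eq _ oO Oy (vertical_al_local_Ltilde j')).
    rewrite (@deriveB _ _ _ (Vd (lshift k j') l)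
      (fun y => \sum_c Vd (lshift k j') (Va c l) y * va c y)); [|exact: diff_derivable..].
    rewrite derive_sum_velocity0 // big1 ?subr0 // => c _.
    by rewrite -/(Vd _ _ _) (vertical_velocity oU sf bf) // eq_rlshift mulr0.
  - rewrite block_mxEur mxE.
    rewrite /Vd [LHS]derive_vertical_b_Ltilde big1 ?oppr0 // => c _.
    by rewrite -/(Vd _ _ _) (vertical_velocity oU sf bf) // eq_rlshift mulr0.
  - by rewrite block_mxEdl mxE.
  - rewrite block_mxEdr !mxE.
    rewrite /Vd [LHS]derive_vertical_b_Ltilde (bigD1 i') //= big1 ?addr0.
      by rewrite -/(Vd _ _ _) (vertical_velocity oU sf bf) // eqxx mulr1.
    move=> c ci; rewrite -/(Vd _ _ _) (vertical_velocity oU sf bf) //.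
    by rewrite eq_rshift (negbTE ci) mulr0.
have : P *m local_hessian lt y *m P^T \in unitmx.
  rewrite GE unitmxE det_lblock unitrM -!unitmxE uD /=.
  by rewrite -scaleN1r unitmxZ ?unitmx_tr // unitrN1.
by rewrite !unitmx_mul => /andP[/andP[]].
Qed.

(** Up to sign the hypothesis is the homogeneous linear system with matrix (g_ab) for the column of
    derivatives of the v^a. *)
Lemma derive_velocity_Ltilde (b : V) :
  (forall a, 'D_((y.2, b) : V * V) (Va a lt) y = 0) ->
  forall a, 'D_((y.2, b) : V * V) (va a) y = 0.
Proof.
move=> E; have ug' := ug; set gG := (\matrix_(a < k, b < k) _) in ug'.
pose d : 'cV[R]_k := \col_a 'D_((y.2, b) : V * V) (va a) y.
suff d0 : d = 0 by move=> a; have := congr1 (fun M : 'cV[R]_k => M a 0) d0; rewrite !mxE.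
rewrite -[d](mulKmx ug'); suff -> : gG *m d = 0 by rewrite mulmx0.
apply/colP => a; have := E a; rewrite derive_vertical_b_Ltilde => /eqP.
rewrite oppr_eq0 => /eqP E'; rewrite !mxE; apply: etrans E'.
by apply: eq_bigr => c _; rewrite !mxE.
Qed.

(** With v^a and their derivatives along (u, b) equal to zero, the frame expansion of u and its
    derivative contain the X_al only. These are the initial data of a curve in C. *)
Lemma tangent_local (b : V) :
  (forall a, 'D_((y.2, b) : V * V) (va a) y = 0) ->
  y.2 = \sum_(al < m) v (lshift k al) y *: f (lshift k al) y.1 /\
  b = \sum_(al < m) ('D_((y.2, b) : V * V) (v (lshift k al)) y *: f (lshift k al) y.1
    + v (lshift k al) y *: 'D_(y.2) (f (lshift k al)) y.1).
Proof.
move=> dv0; split.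
  rewrite [LHS](velocity_sum bf Oy) big_split_ord /= [X in _ + X]big1 ?addr0 //.
  by move=> a _; rewrite v0 scale0r.
have dv i := smooth_differentiable (smooth_velocity oU sf bf i) Oy.
have df i : differentiable (f i) y.1 by exact: smooth_differentiable (sf i) Oy.
have dff i : differentiable (fun y : V * V => f i y.1) y.
  by apply: (@differentiable_comp _ _ _ _ fst (f i)) => //; exact: differentiable_fst.
(* The acceleration is the derivative of the fibre coordinate, which can be expanded in the frame
   before differentiating. *)
transitivity ('D_((y.2, b) : V * V) snd y); first by rewrite derive_snd.
rewrite (derive_open_eq _ oO Oy (velocity_sum bf)) /=.
rewrite derive_bigsum; last by move=> i; exact: differentiable_scale.
rewrite big_split_ord /= [X in _ + X]big1 ?addr0.
  apply: eq_bigr => al _; rewrite derive_scale // derive_comp_fst //.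
  by rewrite addrC.
move=> a _; rewrite derive_scale // v0 dv0 !scale0r addr0 //.
Qed.

End At.
End Local_Ltilde.

(** * Changes of charts *)

Section Jacobian.
Context {R : realType}.

Lemma derive_jacobian m n (f : 'rV[R]_m -> 'rV[R]_n) (x v : 'rV[R]_m) :
  differentiable f x -> 'D_v f x = v *m 'J f x.
Proof. exact: deriveEjacobian. Qed.

Lemma derive_slice (V V' W : normedModType R) (A : set (V * V')) (F : V * V' -> W) x w b :
  open A -> smooth_on A F -> A (x, w) ->
  'D_b (fun w' => F (x, w')) w = 'D_((0, b) : V * V') F (x, w).
Proof.
move=> oA sF Aw.
have dc : differentiable (fun=> x) w by exact: differentiable_cst.
have di : differentiable (id : V' -> V') w by [].
have dF : differentiable F (x, w) by exact: smooth_differentiable sF Aw.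
have := derive_comp b (differentiable_pair dc di) dF.
by rewrite (derive_pair b dc di) derive_cst derive_id.
Qed.

Lemma derive_slice1 (V V' W : normedModType R) (A : set (V * V')) (F : V * V' -> W) x w b :
  open A -> smooth_on A F -> A (x, w) ->
  'D_b (fun x' => F (x', w)) x = 'D_((b, 0) : V * V') F (x, w).
Proof.
move=> oA sF Aw.
have dc : differentiable (fun=> w) x by exact: differentiable_cst.
have di : differentiable (id : V -> V) x by [].
have dF : differentiable F (x, w) by exact: smooth_differentiable sF Aw.
have := derive_comp b (differentiable_pair di dc) dF.
by rewrite (derive_pair b di dc) derive_cst derive_id.
Qed.

Lemma tangent_map_smooth m n (A : set 'rV[R]_m) (f : 'rV[R]_m -> 'rV[R]_n) :
  open A -> smooth_on A f ->
  smooth_on [set y : 'rV[R]_m * 'rV[R]_m | A y.1] (fun y => (f y.1, 'D_(y.2) f y.1)).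
Proof.
move=> oA sf; have oT : open [set y : 'rV[R]_m * 'rV[R]_m | A y.1].
  by apply: open_comp => // y _; exact: cvg_fst.
have sf1 : smooth_on [set y : 'rV[R]_m * 'rV[R]_m | A y.1] (fun y => f y.1).
  apply: (smooth_comp (B := A) (f := fst)) => //; exact: smooth_fst.
apply: smooth_pair => //.
have E y : [set y : 'rV[R]_m * 'rV[R]_m | A y.1] y ->
    'D_((y.2, 0) : 'rV[R]_m * 'rV[R]_m) (fun y => f y.1) y = 'D_(y.2) f y.1.
  by move=> Ay; rewrite derive_comp_fst //; exact: smooth_differentiable sf Ay.
(* Read on the total space, the derivative of f along u is that of (x, u) |-> f x along the smooth
   field (u, 0). *)
apply: (smooth_eq oT E).
apply: smooth_derive_field => //; apply: smooth_pair => //.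
  exact: smooth_snd.
exact: smooth_cst.
Qed.

(** The second tangent map of f. Its second-order term is what the complete lift has to absorb under
    a change of chart. *)
Lemma derive_tangent_map m n (A : set 'rV[R]_m) (f : 'rV[R]_m -> 'rV[R]_n) y a b :
  open A -> smooth_on A f -> A y.1 ->
  'D_((a, b) : 'rV[R]_m * 'rV[R]_m) (fun y => (f y.1, 'D_(y.2) f y.1)) y =
  ('D_a f y.1, 'D_a ('D_(y.2) f) y.1 + 'D_b f y.1).
Proof.
move=> oA sf Ay; set T := [set y : 'rV[R]_m * 'rV[R]_m | A y.1].
have oT : open T by apply: open_comp => // y' _; exact: cvg_fst.
pose g (y : 'rV[R]_m * 'rV[R]_m) := f y.1.
have sf1 : smooth_on T g.
  apply: (smooth_comp (B := A) (f := fst)) => //; exact: smooth_fst.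
have sv : smooth_on T (fun y => (y.2, 0) : 'rV[R]_m * 'rV[R]_m).
  by apply: smooth_pair => //; [exact: smooth_snd|exact: smooth_cst].
have E y' : T y' -> 'D_(y'.2) f y'.1 = 'D_((y'.2, 0) : 'rV[R]_m * 'rV[R]_m) g y'.
  by move=> Ay'; rewrite derive_comp_fst //; exact: smooth_differentiable sf Ay'.
have E' w y' : T y' -> 'D_((w, 0) : 'rV[R]_m * 'rV[R]_m) g y' = 'D_w f y'.1.
  by move=> Ay'; rewrite derive_comp_fst //; exact: smooth_differentiable sf Ay'.
have sg : smooth_on T (fun y => 'D_((y.2, 0) : 'rV[R]_m * 'rV[R]_m) g y).
  exact: smooth_derive_field.
have df1 : differentiable g y by exact: smooth_differentiable sf1 Ay.
have df2 : differentiable (fun y : 'rV[R]_m * 'rV[R]_m => 'D_(y.2) f y.1) y.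
  apply: differentiable_near_eq (smooth_differentiable sg Ay).
  by apply: (open_eq_near (A := T)) => // y' Ty'; rewrite E.
rewrite (derive_pair _ df1 df2) derive_comp_fst /=; last exact: smooth_differentiable sf Ay.
congr (_, _); rewrite (derive_open_eq _ oT Ay E).
rewrite (derive_derive_field _ oT sf1 sv Ay); congr (_ + _).
rewrite (derive_pair (f := snd) (g := fun=> 0)); last 2 first.
- exact: differentiable_snd.
- exact: differentiable_cst.
rewrite derive_snd derive_cst derive_comp_fst //.
exact: smooth_differentiable sf Ay.
Qed.

End Jacobian.

Section Basis.
Context {R : realType} (n : nat).
Local Notation V := 'rV[R]_n.

Lemma coord_unique (t : n.-tuple V) (c : 'I_n -> R) i :
  basis_of fullv t -> coord t i (\sum_j c j *: tnth t j) = c i.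
Proof.
move=> bt; rewrite linear_sum (bigD1 i) //= big1 ?addr0.
  by rewrite linearZ /= coord_tnth // eqxx mulr1.
by move=> j ji; rewrite linearZ /= coord_tnth // eq_sym (negbTE ji) mulr0.
Qed.

(** J carries a linear relation in t' to the same relation in t, so t' is free; counting dimensions
    does the rest. *)
Lemma basis_mulmx (t t' : n.-tuple V) (J : 'M[R]_n) : basis_of fullv t ->
  (forall i, tnth t' i *m J = tnth t i) -> basis_of fullv t'.
Proof.
move=> bt tJ; rewrite basisEfree subvf size_tuple dimvf.
rewrite [X in (X <= n)%N](_ : _ = n) ?leqnn ?andbT; last by rewrite /dim /= mul1n.
apply/freeP => c c0 i.
have : \sum_j c j *: tnth t j = 0.
  transitivity ((\sum_(i < n) c i *: t'`_i) *m J); last by rewrite c0 mul0mx.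
  rewrite mulmx_suml; apply: eq_bigr => j _.
  by rewrite -tJ -scalemxAl (tnth_nth 0).
by move=> /(congr1 (coord t i)); rewrite coord_unique // linear0.
Qed.

Lemma coord_mulmx (t t' : n.-tuple V) (J : 'M[R]_n) i w : basis_of fullv t ->
  (forall i, tnth t' i *m J = tnth t i) -> coord t i (w *m J) = coord t' i w.
Proof.
move=> bt tJ; have bt' := basis_mulmx bt tJ.
rewrite [in LHS](coord_sum bt' w) mulmx_suml.
under eq_bigr do rewrite -scalemxAl tJ.
exact: coord_unique.
Qed.

End Basis.

(** * Charts of the tangent bundle and components of its vector fields *)

Section Charts.
Context {R : realType} (n : nat) (Q : topologicalType) (MQ : manifold R n Q).
Local Notation V := 'rV[R]_n.
Local Notation TQ := (Q * V)%type.
Local Notation dom := (chart_dom MQ).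
Local Notation img := (chart_img MQ).
Local Notation ch := (chart MQ).
Local Notation inv := (chart_inv MQ).

(** Described by means of the inverse chart rather than as an image, so that its openness follows
    from continuity of that inverse. *)
Definition chart_sub (p : Q) (W : set Q) : set V := [set x | img p x /\ W (inv p x)].

Lemma img_inv p x : img p x -> dom p (inv p x) /\ ch p (inv p x) = x.
Proof. by case=> q dq <-; rewrite (chartK dq). Qed.

Lemma dom_img p q : dom p q -> img p (ch p q).
Proof. by move=> dq; exists q. Qed.

Lemma chart_sub_open p W : open W -> open (chart_sub p W).
Proof.
move=> oW; rewrite openE => x [ix Wx]; apply: filterI.
  by apply: open_nbhs_nbhs; split=> //; exact: chart_img_open.
by apply: (chart_inv_continuous ix); exact: open_nbhs_nbhs.
Qed.

Lemma chart_sub_image p W : chart_sub p W = ch p @` (dom p `&` W).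
Proof.
apply/seteqP; split=> [x [ix Wx]|x [q [dq Wq] <-]].
  by have [d e] := img_inv ix; exists (inv p x).
by split; [exact: dom_img|rewrite chartK].
Qed.

Lemma chart_sub_ch p q W : dom p q -> W q -> chart_sub p W (ch p q).
Proof. by move=> dq Wq; split; [exact: dom_img|rewrite chartK]. Qed.

Lemma transition_smooth p p' : smooth_on (chart_sub p (dom p')) (ch p' \o inv p).
Proof. by rewrite chart_sub_image; exact: chart_transition. Qed.

Lemma overlap_open p p' : open (chart_sub p (dom p')).
Proof. by apply: chart_sub_open; exact: chart_dom_open. Qed.

Lemma transition_differentiable p p' x : chart_sub p (dom p') x ->
  differentiable (ch p' \o inv p) x.
Proof. exact: smooth_differentiable (@transition_smooth p p'). Qed.

(** Near x the representative of h in the chart at a is the one in the chart at b composed with the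
    transition map. *)
Lemma chain_charts (W : normedModType R) (a b : Q) x w (h : Q -> W) :
  chart_sub a (dom b) x -> differentiable (h \o inv b) (ch b (inv a x)) ->
  differentiable (h \o inv a) x /\
  'D_('D_w (ch b \o inv a) x) (h \o inv b) (ch b (inv a x)) = 'D_w (h \o inv a) x.
Proof.
move=> ox dh; have dt := transition_differentiable ox.
have E y : chart_sub a (dom b) y -> (h \o inv b) ((ch b \o inv a) y) = (h \o inv a) y.
  by move=> [_ dy] /=; rewrite chartK.
split.
  apply: differentiable_near_eq (differentiable_comp dt dh).
  by apply: (open_eq_near (A := chart_sub a (dom b))) => //; exact: overlap_open.
rewrite -(derive_open_eq w (@overlap_open a b) ox E).
by rewrite (derive_comp w dt dh).
Qed.

Lemma derive_transition_id p x w : img p x -> 'D_w (ch p \o inv p) x = w.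
Proof.
move=> ix.
have ox : chart_sub p (dom p) x by split=> //; case: (img_inv ix).
rewrite (derive_open_eq (g := id) w (@overlap_open p p) ox) ?derive_id //.
by move=> y [iy _] /=; case: (img_inv iy).
Qed.

(** Going to the chart at the base point and back composes two transition maps into the identity
    near y.1, whose derivative is the identity. *)
Lemma tchart_invK p y : img p y.1 -> tchart MQ p (tchart_inv MQ p y) = y.
Proof.
case: y => x w /= ix; rewrite /tchart /tchart_inv /=.
have [dx ex] := img_inv ix; rewrite ex; congr (_, _).
have oq : chart_sub (inv p x) (dom p) (ch (inv p x) (inv p x)).
  by apply: chart_sub_ch => //; exact: chart_dom_center.
have ox : chart_sub p (dom (inv p x)) x by split=> //; exact: chart_dom_center.
have [_ ->] := chain_charts w (h := ch p) ox (transition_differentiable oq).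
exact: derive_transition_id.
Qed.

Lemma tchart_tchart_inv p p' y : chart_sub p (dom p') y.1 ->
  tchart MQ p' (tchart_inv MQ p y) = (ch p' (inv p y.1), 'D_(y.2) (ch p' \o inv p) y.1).
Proof.
case: y => x w /= [ix dx']; rewrite /tchart /tchart_inv /=; congr (_, _).
have oq : chart_sub (inv p x) (dom p') (ch (inv p x) (inv p x)).
  by apply: chart_sub_ch => //; exact: chart_dom_center.
have ox : chart_sub p (dom (inv p x)) x by split=> //; exact: chart_dom_center.
by have [_ ->] := chain_charts w (h := ch p') ox (transition_differentiable oq).
Qed.

Lemma tchartK p z : dom p z.1 -> tchart_inv MQ p (tchart MQ p z) = z.
Proof.
case: z => q u /= dq; rewrite /tchart /tchart_inv /= (chartK dq); congr (_, _).
have cq := chart_dom_center MQ q.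
have oq : chart_sub q (dom p) (ch q q) by exact: chart_sub_ch.
have op : chart_sub p (dom q) (ch p (inv q (ch q q))).
  by rewrite (chartK cq); exact: chart_sub_ch.
have [_] := chain_charts u (h := ch q) oq (transition_differentiable op).
by rewrite (chartK cq) => ->; apply: derive_transition_id; exact: dom_img.
Qed.

Lemma tchart_img p z : dom p z.1 -> img p (tchart MQ p z).1.
Proof. exact: dom_img. Qed.

Lemma tchart_center z : tchart MQ z.1 z = tcenter MQ z.
Proof.
by rewrite /tchart derive_transition_id //; apply: dom_img; exact: chart_dom_center.
Qed.

Lemma tchart_dom_tchart p (N : set TQ) z : dom p z.1 -> N z -> tchart_dom MQ p N (tchart MQ p z).
Proof. by move=> dz Nz; split; [exact: tchart_img|rewrite tchartK]. Qed.

Lemma tchart_dom_over p (W : set Q) (N : set TQ) :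
  N `<=` [set z : TQ | W z.1] -> tchart_dom MQ p N `<=` local_tangent (chart_sub p W).
Proof. by move=> NW y [iy /NW Ny]; split. Qed.

Lemma tangent_transition_derive (q p : Q) y a b : chart_sub q (dom p) y.1 ->
  'D_((a, b) : V * V) (tchart MQ p \o tchart_inv MQ q) y =
  ('D_a (ch p \o inv q) y.1,
   'D_a ('D_(y.2) (ch p \o inv q)) y.1 + 'D_b (ch p \o inv q) y.1).
Proof.
move=> oy; rewrite -(derive_tangent_map a b (@overlap_open q p) (@transition_smooth q p) oy).
have oT : open [set y : V * V | chart_sub q (dom p) y.1].
  by apply: open_comp => [? _|]; [exact: cvg_fst|exact: overlap_open].
by apply: (derive_open_eq _ oT oy) => y' oy'; rewrite /= tchart_tchart_inv.
Qed.

Lemma tangent_transition_differentiable (q p : Q) y : chart_sub q (dom p) y.1 ->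
  differentiable (tchart MQ p \o tchart_inv MQ q) y.
Proof.
move=> oy.
have oT : open [set y : V * V | chart_sub q (dom p) y.1].
  by apply: open_comp => [? _|]; [exact: cvg_fst|exact: overlap_open].
apply: differentiable_near_eq (smooth_differentiable
  (tangent_map_smooth (@overlap_open q p) (@transition_smooth q p)) oy).
by apply: (open_eq_near oT oy) => y' oy'; rewrite /= tchart_tchart_inv.
Qed.

(* The components of A in the coordinates [tchart p]. *)
Definition tvec (p : Q) (A : TQ -> V * V) (z : TQ) : V * V :=
  'D_(A z) (tchart MQ p \o tchart_inv MQ z.1) (tcenter MQ z).

(** Trades the chart at the base point of z for any fixed chart around it, in which the result can
    be differentiated again. *)
Lemma tderiv_chart p A F z : dom p z.1 ->
  differentiable (F \o tchart_inv MQ p) (tchart MQ p z) ->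
  tderiv MQ A F z = 'D_(tvec p A z) (F \o tchart_inv MQ p) (tchart MQ p z).
Proof.
move=> dz dF; have cq := chart_dom_center MQ z.1.
have oq : chart_sub z.1 (dom p) (tcenter MQ z).1 by exact: chart_sub_ch.
have oT : open [set y : V * V | chart_sub z.1 (dom p) y.1].
  by apply: open_comp => [? _|]; [exact: cvg_fst|exact: overlap_open].
have Tz : (tchart MQ p \o tchart_inv MQ z.1) (tcenter MQ z) = tchart MQ p z.
  by rewrite /= -tchart_center tchartK.
rewrite /tderiv (derive_open_eq (g := fun y => (F \o tchart_inv MQ p)
   ((tchart MQ p \o tchart_inv MQ z.1) y)) _ oT oq).
  rewrite (derive_comp _ (tangent_transition_differentiable oq)) Tz //.
move=> y [iy dy] /=; rewrite tchartK //.
Qed.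

Lemma tvec_eq p A z : dom p z.1 -> tvec p A z =
  ('D_((A z).1) (ch p \o inv z.1) (ch z.1 z.1),
   'D_((A z).1) ('D_(z.2) (ch p \o inv z.1)) (ch z.1 z.1) +
   'D_((A z).2) (ch p \o inv z.1) (ch z.1 z.1)).
Proof.
move=> dz; have cq := chart_dom_center MQ z.1.
have oq : chart_sub z.1 (dom p) (tcenter MQ z).1 by exact: chart_sub_ch.
rewrite /tvec; case: (A z) => a b; exact: tangent_transition_derive.
Qed.

Lemma vf_in_ch p q (Z : Q -> V) : dom p q ->
  vf_in MQ p Z (ch p q) = 'D_(Z q) (ch p \o inv q) (ch q q).
Proof. by move=> dq; rewrite /vf_in /tchart /= chartK. Qed.

Lemma vf_in_center q (Z : Q -> V) : vf_in MQ q Z (ch q q) = Z q.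
Proof.
have cq := chart_dom_center MQ q.
by rewrite vf_in_ch // derive_transition_id //; exact: dom_img.
Qed.

Lemma tvec_vertical p Z z : dom p z.1 ->
  tvec p (vertical_lift Z) z = (0, vf_in MQ p Z (ch p z.1)).
Proof.
move=> dz; rewrite tvec_eq // /vertical_lift /= vf_in_ch //.
by rewrite !derive0 add0r.
Qed.

Lemma vf_in_transition p q Z x : chart_sub q (dom p) x ->
  vf_in MQ p Z (ch p (inv q x)) = 'D_(vf_in MQ q Z x) (ch p \o inv q) x.
Proof.
move=> [ix dx]; have [dqx ex] := img_inv ix.
have cq := chart_dom_center MQ (inv q x).
have o1 : chart_sub (inv q x) (dom q) (ch (inv q x) (inv q x)) by exact: chart_sub_ch.
have d2 : differentiable (ch p \o inv q) (ch q (inv (inv q x) (ch (inv q x) (inv q x)))).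
  by rewrite chartK // ex; apply: transition_differentiable.
have [_ E] := chain_charts (Z (inv q x)) (h := ch p) o1 d2.
have E1 := vf_in_ch Z dx; have E2 := vf_in_ch Z dqx; rewrite ex in E2.
by rewrite (chartK cq) ex -E2 -E1 in E.
Qed.

(* Coordinate invariance of the complete lift: this uses the symmetry of the
   second derivatives of the transition map. *)
Lemma tvec_complete p Z (W : set Q) z : open W -> vf_smooth MQ W Z -> W z.1 -> dom p z.1 ->
  tvec p (complete_lift MQ Z) z = (vf_in MQ p Z (ch p z.1),
    'D_((tchart MQ p z).2) (vf_in MQ p Z) (ch p z.1)).
Proof.
case: z => q u /= oW sZ Wq dq; rewrite tvec_eq //= vf_in_ch //; congr (_, _).
have cq := chart_dom_center MQ q.
have oq : chart_sub q (dom p) (ch q q) by exact: chart_sub_ch.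
pose A := chart_sub q (dom p) `&` chart_sub q W.
have oA : open A by apply: openI; [exact: overlap_open|exact: chart_sub_open].
have Aq : A (ch q q) by split=> //; exact: chart_sub_ch.
have sphi : smooth_on A (ch p \o inv q) by apply: smooth_sub (@transition_smooth q p) => x [].
have sZq : smooth_on A (vf_in MQ q Z).
  by apply: smooth_sub (sZ q) => x [_]; rewrite chart_sub_image.
have dZp : differentiable (vf_in MQ p Z) ((ch p \o inv q) (ch q q)).
  rewrite /= chartK //; apply: smooth_differentiable (sZ p) _.
  by rewrite -chart_sub_image; exact: chart_sub_ch.
have dphi := transition_differentiable oq.
have E x : A x -> vf_in MQ p Z ((ch p \o inv q) x) = 'D_(vf_in MQ q Z x) (ch p \o inv q) x.
  by move=> [ox _]; rewrite -vf_in_transition.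
have := derive_comp u dphi dZp.
rewrite (derive_open_eq u oA Aq E) (derive_derive_field u oA sphi sZq Aq) vf_in_center.
by rewrite (schwarz u (Z q) oA sphi Aq) /= chartK // => <-.
Qed.

End Charts.

(** * Fibre derivatives and the velocity Hessian under a change of chart *)

Section Slices.
Context {R : realType} (V V' W W' : normedModType R).
Variables (A : set (V * W)) (A' : set (V' * W')) (F : V * W -> R) (F' : V' * W' -> R).
Variables (g : {linear W -> W'}) (x : V) (x' : V').
Hypothesis oA : open A.
Hypothesis sF : smooth_on A F.
Hypothesis sF' : smooth_on A' F'.
Hypothesis dg : forall w, differentiable g w.
Hypothesis AA' : forall w, A (x, w) -> A' (x', g w).
Hypothesis FF' : forall w, F (x, w) = F' (x', g w).

Lemma derive_slice_linear (f : V' * W' -> R) w b : smooth_on A' f -> A' (x', g w) ->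
  'D_b (fun w => f (x', g w)) w = 'D_((0, g b) : V' * W') f (x', g w).
Proof.
move=> sf Aw.
have dc : differentiable (fun=> x') w by exact: differentiable_cst.
have := derive_comp b (differentiable_pair dc (dg w)) (smooth_differentiable sf Aw).
by rewrite (derive_pair b dc (dg w)) derive_cst derive_linear.
Qed.

(** Over one base point the two functions differ by a linear substitution, so second fibre
    derivatives correspond without a correction term. *)
Lemma derive2_slice u a b : A (x, u) ->
  'D_((0, a) : V * W) (fun y => 'D_((0, b) : V * W) F y) (x, u) =
  'D_((0, g a) : V' * W') (fun y => 'D_((0, g b) : V' * W') F' y) (x', g u).
Proof.
move=> Au; pose S := [set w : W | A (x, w)].
have oS : open S.
  have cp : continuous (fun w : W => (x, w)).
    move=> w; have dp : differentiable (fun w : W => (x, w)) w.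
      by apply: differentiable_pair => //; exact: differentiable_cst.
    exact: differentiable_continuous dp.
  by apply: (@open_comp _ _ (fun w : W => (x, w)) _ _ oA) => w _; exact: cp.
have FFE : (fun w => F (x, w)) = (fun w => F' (x', g w)) by exact/funext.
have D1 w : S w -> 'D_((0, b) : V * W) F (x, w) = 'D_((0, g b) : V' * W') F' (x', g w).
  move=> Aw; rewrite -(derive_slice _ oA sF Aw).
  by rewrite -(derive_slice_linear _ sF' (AA' Aw)) FFE.
rewrite -(derive_slice a oA (smooth_derive ((0, b) : V * W) sF) Au).
rewrite -(derive_slice_linear a (smooth_derive ((0, g b) : V' * W') sF') (AA' Au)).
exact: (derive_open_eq a oS Au D1).
Qed.

End Slices.

Section Hessian.
Context {R : realType} (n : nat) (Q : topologicalType) (MQ : manifold R n Q).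
Local Notation V := 'rV[R]_n.
Local Notation TQ := (Q * V)%type.
Local Notation dom := (chart_dom MQ).
Local Notation ch := (chart MQ).
Local Notation inv := (chart_inv MQ).

Lemma differentiable_mulmxr (J : 'M[R]_n) (w : V) : differentiable (mulmxr J : V -> V) w.
Proof.
have sm : smooth_on setT (fun w : V => w *m J).
  have oT := @openT V.
  apply/smooth_rowP => // j; apply: smooth_mulmx => // i' j'; last exact: smooth_cst.
  by apply: smooth_entry => //; apply: (@smooth_lin _ _ _ setT idfun) => ?; exact: cvg_id.
exact: smooth_differentiable sm _.
Qed.

Definition transition_jac (q p : Q) : 'M[R]_n := 'J (ch p \o inv q) (ch q q).

Lemma transition_jacE (q p : Q) (u : V) : dom p q ->
  'D_u (ch p \o inv q) (ch q q) = u *m transition_jac q p.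
Proof.
move=> dq; apply: derive_jacobian; apply: transition_differentiable.
by apply: chart_sub_ch => //; exact: chart_dom_center.
Qed.

Lemma tchartE p z : dom p z.1 ->
  tchart MQ p z = (ch p z.1, z.2 *m transition_jac z.1 p).
Proof. by move=> dz; rewrite /tchart transition_jacE. Qed.

(** The Jacobian of the opposite transition is the inverse. *)
Lemma transition_jac_unit (q p : Q) : dom p q -> transition_jac q p \in unitmx.
Proof.
move=> dq; have cq := chart_dom_center MQ q.
have op : chart_sub MQ p (dom q) (ch p q) by exact: chart_sub_ch.
have oq : chart_sub MQ q (dom p) (ch q q) by exact: chart_sub_ch.
have dt := transition_differentiable op.
pose J := 'J (ch q \o inv p) (ch p q).
have JE (u : V) : 'D_u (ch q \o inv p) (ch p q) = u *m J by exact: derive_jacobian.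
clearbody J; have JJ : transition_jac q p *m J = 1%:M; last first.
  by have [H _] := mulmx1_unit JJ; exact: H.
apply/row_matrixP => i; rewrite row_mul row1 rowE -(transition_jacE _ dq) -JE.
have dt' : differentiable (ch q \o inv p) (ch p (inv q (ch q q))) by rewrite (chartK cq).
have [_] := chain_charts (delta_mx 0 i) (h := ch q) oq dt'.
by rewrite (chartK cq) => ->; apply: derive_transition_id; exact: dom_img.
Qed.

(** Only fibre derivatives occur, and a change of chart is linear on the fibre: the Hessian
    transforms as a bilinear form. *)
Lemma hessian_chart (N : set TQ) (F : TQ -> R) p z :
  topen MQ N -> tsmooth MQ N F -> N z -> dom p z.1 ->
  hessian MQ F z = transition_jac z.1 p *m
    local_hessian (F \o tchart_inv MQ p) (tchart MQ p z) *m (transition_jac z.1 p)^T.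
Proof.
case: z => q u /= oN sF Nz dq; set J := transition_jac q p.
set Fp := F \o tchart_inv MQ p; set Fq := F \o tchart_inv MQ q.
have cq := chart_dom_center MQ q.
have tz : tchart MQ q (q, u) = (ch q q, u) by rewrite (@tchart_center _ _ _ MQ (q, u)).
have Az : tchart_dom MQ q N (ch q q, u) by rewrite -tz; apply: tchart_dom_tchart.
have TE (w' : V) : tchart MQ p (tchart_inv MQ q (ch q q, w')) = (ch p q, w' *m J).
  rewrite tchart_tchart_inv /=; last exact: chart_sub_ch.
  by rewrite chartK // transition_jacE.
have dz w' : dom p (tchart_inv MQ q (ch q q, w')).1 by rewrite /= chartK.
have Sp (w' : V) : tchart_dom MQ q N (ch q q, w') -> tchart_dom MQ p N (ch p q, w' *m J).
  by move=> [_ Nw]; rewrite -TE; apply: tchart_dom_tchart.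
have FE (w' : V) : Fq (ch q q, w') = Fp (ch p q, w' *m J).
  by rewrite /Fp /Fq /= -TE tchartK.
have sFq : smooth_on (tchart_dom MQ q N) Fq := sF q.
have sFp : smooth_on (tchart_dom MQ p N) Fp := sF p.
have tpz : tchart MQ p (q, u) = (ch p q, u *m J) by exact: (@tchartE p (q, u)).
have HE i j : hessian MQ F (q, u) i j = 'D_((0, delta_mx 0 i) : V * V)
    (fun y => 'D_((0, delta_mx 0 j) : V * V) Fq y) (ch q q, u) by rewrite mxE.
rewrite tpz; clearbody J Fp Fq.
have D2 (a b : V) := derive2_slice (g := mulmxr J) (oN q) sFq sFp
  (@differentiable_mulmxr J) Sp FE a b Az.
apply/matrixP => i j; rewrite HE D2.
rewrite (local_hessianE _ _ (oN p) sFp (Sp _ Az)) mxE [in RHS]mxE.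
apply: eq_bigr => c _; congr (_ * _).
  by rewrite -mulmxA -rowE [LHS]mxE.
by rewrite /= -rowE [LHS]mxE [LHS]mxE [RHS]mxE.
Qed.

Lemma hessian_unit_chart (N : set TQ) (F : TQ -> R) p z :
  topen MQ N -> tsmooth MQ N F -> N z -> dom p z.1 ->
  (hessian MQ F z \in unitmx) =
  (local_hessian (F \o tchart_inv MQ p) (tchart MQ p z) \in unitmx).
Proof.
move=> oN sF Nz dz; rewrite (hessian_chart oN sF Nz dz) !unitmx_mul unitmx_tr.
by rewrite transition_jac_unit // andbT.
Qed.

End Hessian.

(** * The frame and the Euler-Lagrange equations of a function on TQ, read in a chart *)

Section Frame_chart.
Context {R : realType} (n : nat) (Q : topologicalType) (MQ : manifold R n Q).
Local Notation V := 'rV[R]_n.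
Local Notation TQ := (Q * V)%type.
Local Notation dom := (chart_dom MQ).
Local Notation ch := (chart MQ).
Local Notation inv := (chart_inv MQ).

Variables (W : set Q) (fr : 'I_n -> Q -> V).
Hypothesis oW : open W.
Hypothesis sfr : forall i, vf_smooth MQ W (fr i).
Hypothesis bfr : forall q, W q -> basis_of fullv [tuple fr i q | i < n].
Local Notation U p := (chart_sub MQ p W).
Definition frame_in (p : Q) (i : 'I_n) : V -> V := vf_in MQ p (fr i).

Lemma frame_in_smooth p i : smooth_on (U p) (frame_in p i).
Proof. by rewrite chart_sub_image; exact: sfr. Qed.

Lemma frame_in_jac p i q : dom p q -> frame_in p i (ch p q) = fr i q *m transition_jac MQ q p.
Proof. by move=> dq; rewrite /frame_in vf_in_ch // transition_jacE. Qed.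

Lemma frame_in_invjac p q i : dom p q ->
  tnth [tuple frame_in p i (ch p q) | i < n] i *m invmx (transition_jac MQ q p) =
  tnth [tuple fr i q | i < n] i.
Proof.
by move=> dq; rewrite !tnth_mktuple frame_in_jac // mulmxK // transition_jac_unit.
Qed.

Lemma frame_in_basis p x : U p x -> basis_of fullv [tuple frame_in p i x | i < n].
Proof.
move=> [ix Wx]; have [dx ex] := img_inv ix; rewrite -ex.
by apply: (basis_mulmx (bfr Wx)) => i; exact: frame_in_invjac.
Qed.

Lemma velocity_in p i z : W z.1 -> dom p z.1 ->
  coord [tuple fr i z.1 | i < n] i z.2 =
  local_velocity (frame_in p) i (tchart MQ p z).
Proof.
move=> Wz dz; rewrite tchartE // /local_velocity /=.
rewrite -(coord_mulmx _ _ (bfr Wz) (fun j => frame_in_invjac j dz)).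
by rewrite mulmxK // transition_jac_unit.
Qed.

Lemma vertical_in p i F z : dom p z.1 ->
  differentiable (F \o tchart_inv MQ p) (tchart MQ p z) ->
  tderiv MQ (vertical_lift (fr i)) F z =
  local_vertical (frame_in p) i (F \o tchart_inv MQ p) (tchart MQ p z).
Proof. by move=> dz dF; rewrite (tderiv_chart _ dz dF) tvec_vertical. Qed.

Lemma complete_in p i F z : W z.1 -> dom p z.1 ->
  differentiable (F \o tchart_inv MQ p) (tchart MQ p z) ->
  tderiv MQ (complete_lift MQ (fr i)) F z =
  local_complete (frame_in p) i (F \o tchart_inv MQ p) (tchart MQ p z).
Proof.
by move=> Wz dz dF; rewrite (tderiv_chart _ dz dF) (tvec_complete oW (sfr i)).
Qed.

Lemma tchart_dom_sub p (N : set TQ) : N `<=` [set z : TQ | W z.1] ->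
  tchart_dom MQ p N `<=` local_tangent (U p).
Proof. exact: tchart_dom_over. Qed.

Section Smooth_function.
Variables (N : set TQ) (F : TQ -> R).
Hypothesis oN : topen MQ N.
Hypothesis NW : N `<=` [set z : TQ | W z.1].
Hypothesis sF : tsmooth MQ N F.
Local Notation Fp p := (F \o tchart_inv MQ p).

(** Valid on an open set of the chart and not at one point only, hence open to a second
    differentiation. *)
Lemma vertical_in_eq p i y : tchart_dom MQ p N y ->
  tderiv MQ (vertical_lift (fr i)) F (tchart_inv MQ p y) =
  local_vertical (frame_in p) i (Fp p) y.
Proof.
move=> Ay; have [iy _] := Ay; have [dy _] := img_inv iy.
have E : tchart MQ p (tchart_inv MQ p y) = y := tchart_invK iy.
have dF := smooth_differentiable (@sF p) Ay; rewrite -E in dF.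
by rewrite (@vertical_in p i F (tchart_inv MQ p y) dy dF) E.
Qed.

Lemma tsmooth_vertical i : tsmooth MQ N (fun z => tderiv MQ (vertical_lift (fr i)) F z).
Proof.
move=> p; have E y : tchart_dom MQ p N y -> local_vertical (frame_in p) i (Fp p) y =
    tderiv MQ (vertical_lift (fr i)) F (tchart_inv MQ p y).
  by move=> Ay; rewrite -vertical_in_eq.
apply: (smooth_eq (@oN p) E).
exact: (smooth_vertical (@frame_in_smooth p) i (@oN p) (tchart_dom_sub NW) (@sF p)).
Qed.

Lemma vertical_vertical_in p i j z : N z -> dom p z.1 ->
  tderiv MQ (vertical_lift (fr i)) (fun z => tderiv MQ (vertical_lift (fr j)) F z) z =
  local_vertical (frame_in p) i (local_vertical (frame_in p) j (Fp p)) (tchart MQ p z).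
Proof.
move=> Nz dz; have Az : tchart_dom MQ p N (tchart MQ p z) by exact: tchart_dom_tchart.
rewrite (vertical_in _ dz); last exact: smooth_differentiable (tsmooth_vertical j p) Az.
exact: (derive_open_eq _ (@oN p) Az (@vertical_in_eq p j)).
Qed.

Lemma euler_lagrange_in p (Gam : TQ -> V * V) z : N z -> dom p z.1 -> (Gam z).1 = z.2 ->
  (forall i, tderiv MQ Gam (fun z => tderiv MQ (vertical_lift (fr i)) F z) z -
     tderiv MQ (complete_lift MQ (fr i)) F z = 0) <->
  (tvec MQ p Gam z).2 *m local_hessian (Fp p) (tchart MQ p z) =
    local_force (Fp p) (tchart MQ p z).
Proof.
move=> Nz dz Gz; have Az : tchart_dom MQ p N (tchart MQ p z) by exact: tchart_dom_tchart.
(* The second-order condition identifies the base component of [Gam] in the chart at p with the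
   velocity coordinate. *)
have tE : tvec MQ p Gam z = ((tchart MQ p z).2, (tvec MQ p Gam z).2).
  have t1 : (tvec MQ p Gam z).1 = (tchart MQ p z).2 by rewrite tvec_eq //= Gz.
  by rewrite [LHS]surjective_pairing t1.
rewrite -(euler_lagrange_iff (@frame_in_smooth p)
  (@frame_in_basis p) _ (@oN p) (tchart_dom_sub NW) (@sF p) Az) -tE.
have E i : tderiv MQ Gam (fun z => tderiv MQ (vertical_lift (fr i)) F z) z -
     tderiv MQ (complete_lift MQ (fr i)) F z =
   'D_(tvec MQ p Gam z) (local_vertical (frame_in p) i (Fp p)) (tchart MQ p z) -
     local_complete (frame_in p) i (Fp p) (tchart MQ p z).
  rewrite (tderiv_chart _ dz); last exact: smooth_differentiable (tsmooth_vertical i p) Az.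
  rewrite (complete_in _ (NW Nz) dz); last exact: smooth_differentiable (@sF p) Az.
  have X := derive_open_eq (tvec MQ p Gam z) (@oN p) Az (@vertical_in_eq p i).
  exact: (congr1 (fun t : R => t - local_complete (frame_in p) i (Fp p) (tchart MQ p z)) X).
split=> H i; first exact: etrans (esym (E i)) (H i).
exact: etrans (E i) (H i).
Qed.

End Smooth_function.
End Frame_chart.

(** * Tangent maps and the group action *)

Section Tangent_map.
Context {R : realType}.

(* Without continuity at p the expression in the chart at h p would be
   meaningless near p. *)
Definition tdiff n n' (M N : topologicalType) (MM : manifold R n M)
    (MN : manifold R n' N) (h : M -> N) (p : M) : Prop :=
  {for p, continuous h} /\
  differentiable (fun x => chart MN (h p) (h (chart_inv MM p x))) (chart MM p p).

Section One.
Variables (n n' : nat) (M N : topologicalType) (MM : manifold R n M) (MN : manifold R n' N).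

Lemma chart_inv_near (p : M) (P : set M) : nbhs p P ->
  \forall x \near chart MM p p, P (chart_inv MM p x).
Proof.
have cp := chart_dom_center MM p.
move=> nP; apply: (chart_inv_continuous (dom_img cp)).
by rewrite (chartK cp).
Qed.

Lemma chart_dom_near (h : M -> N) p (p' : N) : {for p, continuous h} -> chart_dom MN p' (h p) ->
  \forall x \near chart MM p p, chart_dom MN p' (h (chart_inv MM p x)).
Proof.
move=> ch dh; apply: (@chart_inv_near p (fun q => chart_dom MN p' (h q))).
by apply: ch; apply: open_nbhs_nbhs; split=> //; exact: chart_dom_open.
Qed.

Lemma tmap_chart (h : M -> N) p p' u : tdiff MM MN h p -> chart_dom MN p' (h p) ->
  'D_(tmap MM MN h p u) (chart MN p' \o chart_inv MN (h p)) (chart MN (h p) (h p)) =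
  'D_u (fun x => chart MN p' (h (chart_inv MM p x))) (chart MM p p).
Proof.
move=> [ch dh] dp'; have cp := chart_dom_center MM p; have chp := chart_dom_center MN (h p).
have E : \forall x \near chart MM p p, (chart MN p' \o chart_inv MN (h p))
    (chart MN (h p) (h (chart_inv MM p x))) = chart MN p' (h (chart_inv MM p x)).
  by apply: filterS (chart_dom_near ch chp) => x dx /=; rewrite (chartK dx).
rewrite -(near_eq_derive u E).
have dt : differentiable (chart MN p' \o chart_inv MN (h p))
    (chart MN (h p) (h (chart_inv MM p (chart MM p p)))).
  by rewrite (chartK cp); apply: transition_differentiable; exact: chart_sub_ch.
by rewrite (derive_comp u dh dt) (chartK cp).
Qed.

Lemma tmapP (h : M -> N) p a u v : tdiff MM MN h p ->
  tmap MM MN h p (a *: u + v) = a *: tmap MM MN h p u + tmap MM MN h p v.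
Proof. by move=> [_ dh]; exact: derive_dirP. Qed.

Lemma tmap_sum (h : M -> N) p (I : finType) (c : I -> R) (u : I -> 'rV[R]_n) :
  tdiff MM MN h p ->
  tmap MM MN h p (\sum_i c i *: u i) = \sum_i c i *: tmap MM MN h p (u i).
Proof.
move=> [_ dh]; rewrite /tmap derive_dir_sum //.
by apply: eq_bigr => i _; rewrite derive_dirZ.
Qed.

End One.

(** Continuity of h1 keeps its values near p inside the chart at h1 p, where the local
    representatives compose. *)
Lemma tmap_comp n1 n2 n3 (M1 M2 M3 : topologicalType) (MM1 : manifold R n1 M1)
    (MM2 : manifold R n2 M2) (MM3 : manifold R n3 M3) (h1 : M1 -> M2) (h2 : M2 -> M3) p u :
  tdiff MM1 MM2 h1 p -> tdiff MM2 MM3 h2 (h1 p) ->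
  tdiff MM1 MM3 (h2 \o h1) p /\
  tmap MM1 MM3 (h2 \o h1) p u = tmap MM2 MM3 h2 (h1 p) (tmap MM1 MM2 h1 p u).
Proof.
move=> [c1 d1] [c2 d2]; have cp := chart_dom_center MM1 p.
have chp := chart_dom_center MM2 (h1 p).
pose r1 x := chart MM2 (h1 p) (h1 (chart_inv MM1 p x)).
pose r2 x := chart MM3 (h2 (h1 p)) (h2 (chart_inv MM2 (h1 p) x)).
have E : \forall x \near chart MM1 p p, r2 (r1 x) =
    chart MM3 ((h2 \o h1) p) ((h2 \o h1) (chart_inv MM1 p x)).
  by apply: filterS (chart_dom_near MM1 c1 chp) => x dx; rewrite /r2 /r1 (chartK dx).
have r1p : r1 (chart MM1 p p) = chart MM2 (h1 p) (h1 p) by rewrite /r1 (chartK cp).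
have d2' : differentiable r2 (r1 (chart MM1 p p)) by rewrite r1p.
split.
  split; first exact: continuous_comp.
  exact: differentiable_near_eq E (differentiable_comp d1 d2').
have d1' : differentiable r1 (chart MM1 p p) := d1.
by rewrite /tmap -(near_eq_derive u E) (derive_comp u d1' d2') r1p.
Qed.

(** * Partial maps of a jointly smooth map *)

Section Partial.
Variables (n n' n'' : nat) (M N P : topologicalType) (MM : manifold R n M)
  (MN : manifold R n' N) (MP : manifold R n'' P) (f : M -> N -> P).
Hypothesis sf : smooth_map2 MM MN MP f.

Definition product_dom (a : M) (b : N) (c : P) : set ('rV[R]_n * 'rV[R]_n') :=
  [set z | [/\ chart_img MM a z.1, chart_img MN b z.2
        & chart_dom MP c (f (chart_inv MM a z.1) (chart_inv MN b z.2))]].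

Definition product_rep (a : M) (b : N) (c : P) (z : 'rV[R]_n * 'rV[R]_n') : 'rV[R]_n'' :=
  chart MP c (f (chart_inv MM a z.1) (chart_inv MN b z.2)).

Lemma product_rep_smooth a b c : smooth_on (product_dom a b c) (product_rep a b c).
Proof. by case: sf => _; exact. Qed.

Lemma product_dom_open a b c : open (product_dom a b c).
Proof.
case: sf => cf _; rewrite openE => -[x y] /= [ix iy d]; rewrite /interior.
have nx : \forall z \near (x, y), chart_img MM a z.1.
  have : nbhs x (chart_img MM a).
    by apply: open_nbhs_nbhs; split=> //; exact: chart_img_open.
  by apply: cvg_fst.
have ny : \forall z \near (x, y), chart_img MN b z.2.
  have : nbhs y (chart_img MN b).
    by apply: open_nbhs_nbhs; split=> //; exact: chart_img_open.
  by apply: cvg_snd.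
have nd : \forall z \near (x, y),
    chart_dom MP c (f (chart_inv MM a z.1) (chart_inv MN b z.2)).
  have cc : {for (x, y), continuous (fun z : 'rV[R]_n * 'rV[R]_n' =>
      (chart_inv MM a z.1, chart_inv MN b z.2))}.
    apply: cvg_pair.
      by apply: continuous_comp; [exact: cvg_fst|exact: (chart_inv_continuous ix)].
    by apply: continuous_comp; [exact: cvg_snd|exact: (chart_inv_continuous iy)].
  have := @continuous_comp _ _ _ _ (fun z : M * N => f z.1 z.2) (x, y) cc (cf _).
  by apply; apply: open_nbhs_nbhs; split=> //; exact: chart_dom_open.
by apply: filterS3 nx ny nd => z ? ? ?; split.
Qed.

Lemma product_dom_center a b : product_dom a b (f a b) (chart MM a a, chart MN b b).
Proof.
have ca := chart_dom_center MM a; have cb := chart_dom_center MN b.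
split; [exact: dom_img|exact: dom_img|rewrite /= (chartK ca) (chartK cb)].
exact: chart_dom_center.
Qed.

Lemma partial_r_tdiff a b : tdiff MN MP (f a) b.
Proof.
have ca := chart_dom_center MM a; split.
  case: sf => cf _; have cc : {for b, continuous (fun b : N => (a, b))}.
    by apply: cvg_pair; [exact: cvg_cst|exact: cvg_id].
  exact: (@continuous_comp _ _ _ _ (fun z : M * N => f z.1 z.2) b cc (cf _)).
have dp : differentiable (fun y => (chart MM a a, y)) (chart MN b b).
  by apply: differentiable_pair => //; exact: differentiable_cst.
have dr := smooth_differentiable (@product_rep_smooth a b (f a b)) (product_dom_center a b).
have := differentiable_comp dp dr.
rewrite (_ : _ \o _ = fun x => chart MP (f a b) (f a (chart_inv MN b x))) //.
by apply/funext => y; rewrite /product_rep /= (chartK ca).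
Qed.

Lemma partial_l_tdiff a b : tdiff MM MP (f^~ b) a.
Proof.
have cb := chart_dom_center MN b; split.
  case: sf => cf _; have cc : {for a, continuous (fun a : M => (a, b))}.
    by apply: cvg_pair; [exact: cvg_id|exact: cvg_cst].
  exact: (@continuous_comp _ _ _ _ (fun z : M * N => f z.1 z.2) a cc (cf _)).
have dp : differentiable (fun x => (x, chart MN b b)) (chart MM a a).
  by apply: differentiable_pair => //; exact: differentiable_cst.
have dr := smooth_differentiable (@product_rep_smooth a b (f a b)) (product_dom_center a b).
have := differentiable_comp dp dr.
rewrite (_ : _ \o _ = fun x => chart MP (f a b) (f (chart_inv MM a x) b)) //.
by apply/funext => y; rewrite /product_rep /= (chartK cb).
Qed.

End Partial.
End Tangent_map.

(** * Fundamental vector fields and the tangent action *)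

Section Action.
Context {R : realType} (m k : nat) (Q : topologicalType) (G : GroupSpace.type).
Variables (MQ : manifold R (m + k) Q) (MG : manifold R k G) (act : G -> Q -> Q).
Local Notation n := (m + k)%N.
Local Notation V := 'rV[R]_n.
Local Notation TQ := (Q * V)%type.
Local Notation dom := (chart_dom MQ).
Local Notation ch := (chart MQ).
Local Notation inv := (chart_inv MQ).
Hypothesis lG : is_lie_group MG.
Hypothesis aG : is_action act.
Hypothesis sG : smooth_map2 MG MQ MQ act.

Local Notation one := (1%g : G).
Local Notation s0 := (chart MG one one).
Let act1 q : act one q = q. Proof. by case: aG. Qed.
Let actM g h q : act (g * h)%g q = act g (act h q). Proof. by case: aG. Qed.

Lemma act_tdiff g q : tdiff MQ MQ (act g) q.
Proof. exact: (partial_r_tdiff sG). Qed.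

Lemma orbit_tdiff g q : tdiff MG MQ (act^~ q) g.
Proof. exact: (partial_l_tdiff sG). Qed.

(* eta = Ad_g xi, from g h q = (g h g^-1) g q. *)
Lemma tmap_fundamental g q xi :
  exists eta, tmap MQ MQ (act g) q (fundamental MQ MG act xi q) =
              fundamental MQ MG act eta (act g q).
Proof.
have d1 : tdiff MG MG (fun h : G => (g * h)%g) one := partial_r_tdiff lG.1 g one.
have d2 : tdiff MG MG (fun h : G => (h * g^-1)%g) (g * one)%g :=
  partial_l_tdiff lG.1 (g * one)%g g^-1%g.
pose conj := (fun h : G => (h * g^-1)%g) \o (fun h : G => (g * h)%g).
have dc : tdiff MG MG conj one by have [] := tmap_comp xi d1 d2.
have conjE h : conj h = (g * h * g^-1)%g by [].
have c1 : conj one = one by rewrite /conj /= mulg1 mulgV.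
exists (tmap MG MG conj one xi).
have dorb : tdiff MG MQ (act^~ (act g q)) (conj one) by exact: orbit_tdiff.
have [_] := tmap_comp xi dc dorb.
clearbody conj; rewrite c1 /fundamental => <-.
have dq : tdiff MQ MQ (act g) (act one q) by exact: act_tdiff.
have [_] := tmap_comp xi (orbit_tdiff one q) dq.
have hE : act g \o act^~ q = act^~ (act g q) \o conj.
  by apply/funext => h; rewrite /= conjE -!actM -[(_ * g)%g]mulgA mulVg mulg1.
by rewrite act1 hE => <-.
Qed.

Lemma fundamental_sum (I : finType) (c : I -> R) (xi : I -> 'rV[R]_k) q :
  fundamental MQ MG act (\sum_i c i *: xi i) q =
  \sum_i c i *: fundamental MQ MG act (xi i) q.
Proof. exact/tmap_sum/orbit_tdiff. Qed.

Local Notation adom q := (product_dom MG MQ MQ act one q q).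
Local Notation arep q := (product_rep MG MQ MQ act one q q).

Lemma act_dom_one q x : chart_img MQ q x -> adom q (s0, x).
Proof.
move=> ix; have c1 := chart_dom_center MG one; split=> //; first exact: dom_img.
by rewrite /= (chartK c1) act1; case: (img_inv ix).
Qed.

Lemma act_rep_one q x : chart_img MQ q x -> arep q (s0, x) = x.
Proof.
move=> ix; have c1 := chart_dom_center MG one.
by rewrite /product_rep /= (chartK c1) act1; case: (img_inv ix).
Qed.

(** Exhibits the fundamental field as a partial derivative, at the identity, of the jointly smooth
    local action. Its smoothness follows, and so does, by exchanging derivatives, the formula for
    its complete lift. *)
Lemma fundamental_in q xi x : chart_img MQ q x ->
  vf_in MQ q (fundamental MQ MG act xi) x =
  'D_((xi, 0) : 'rV[R]_k * V) (arep q) (s0, x).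
Proof.
move=> ix; have [dx ex] := img_inv ix; rewrite -[in LHS]ex vf_in_ch //.
have d1 : dom q (act one (inv q x)) by rewrite act1.
have := tmap_chart xi (orbit_tdiff one (inv q x)) d1.
rewrite act1 -/(fundamental MQ MG act xi (inv q x)) => ->.
have oA : open (adom q) by exact: product_dom_open.
have sA : smooth_on (adom q) (arep q) by exact: (product_rep_smooth sG).
exact: (derive_slice1 xi oA sA (act_dom_one ix)).
Qed.

Lemma fundamental_smooth xi (W : set Q) : open W -> vf_smooth MQ W (fundamental MQ MG act xi).
Proof.
move=> oW q; rewrite -chart_sub_image.
have oU : open (chart_sub MQ q W) by exact: chart_sub_open.
have E x : chart_sub MQ q W x -> 'D_((xi, 0) : 'rV[R]_k * V) (arep q) (s0, x) =
    vf_in MQ q (fundamental MQ MG act xi) x.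
  by move=> [ix _]; rewrite fundamental_in.
apply: (smooth_eq oU E).
apply: (smooth_comp (B := adom q) (f := fun x => (s0, x))
  (g := 'D_((xi, 0) : 'rV[R]_k * V) (arep q))) => //.
- by move=> x [ix _]; exact: act_dom_one.
- apply: smooth_pair => //; first exact: smooth_cst.
  by apply: (@smooth_lin _ _ _ _ idfun) => ?; exact: cvg_id.
- by apply: smooth_derive; exact: (product_rep_smooth sG).
Qed.

Lemma tchart_tact p g z : dom p (act g z.1) -> tchart MQ p (tact MQ act g z) =
  (ch p (act g z.1), 'D_(z.2) (fun x => ch p (act g (inv z.1 x))) (ch z.1 z.1)).
Proof.
move=> dz; rewrite /tchart /tact /=; congr (_, _).
exact: (tmap_chart z.2 (act_tdiff g z.1) dz).
Qed.

(* The flow of the complete lift is the tangent action; the derivative in the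
   group direction and the one along u commute. *)
Lemma complete_fundamental (F : TQ -> R) xi z :
  differentiable (F \o tchart_inv MQ z.1) (tcenter MQ z) ->
  (forall g, F (tact MQ act g z) = F z) ->
  tderiv MQ (complete_lift MQ (fundamental MQ MG act xi)) F z = 0.
Proof.
case: z => q u /=; rewrite /tderiv /tcenter /complete_lift /=.
set Fq := F \o tchart_inv MQ q; set c := ch q q => dF Finv.
have cq := chart_dom_center MQ q; have c1 := chart_dom_center MG one.
have ic : chart_img MQ q c by exact: dom_img.
have oA : open (adom q) by exact: product_dom_open.
have sA : smooth_on (adom q) (arep q) by exact: (product_rep_smooth sG).
have Ac : adom q (s0, c) by exact: act_dom_one.
(* Coordinates of (q, u) moved by the group element with coordinate s: base point [al1], velocity
   [al2]. F is constant along this family, whose derivative at the identity along xi is the complete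
   lift. *)
pose al1 (s : 'rV[R]_k) := arep q (s, c).
pose al2 (s : 'rV[R]_k) := 'D_((0, u) : 'rV[R]_k * V) (arep q) (s, c).
have dps : differentiable (fun s : 'rV[R]_k => (s, c)) s0.
  by apply: differentiable_pair => //; exact: differentiable_cst.
have d1 : differentiable al1 s0.
  exact: (differentiable_comp dps (smooth_differentiable sA Ac)).
have d2 : differentiable al2 s0.
  exact: (differentiable_comp dps (smooth_differentiable (smooth_derive ((0, u) : 'rV[R]_k * V) sA) Ac)).
have img_open : open (chart_img MQ q) by exact: chart_img_open.
have e1 : al1 s0 = c by exact: act_rep_one.
have e2 : al2 s0 = u.
  rewrite /al2 -(derive_slice u oA sA Ac).
  by rewrite (derive_open_eq (g := id) u img_open ic) ?derive_id // => x ix; exact: act_rep_one.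
have D1 : 'D_xi al1 s0 = fundamental MQ MG act xi q.
  rewrite /al1 (derive_slice1 xi oA sA Ac) -fundamental_in //.
  exact: vf_in_center.
have D2 : 'D_xi al2 s0 = 'D_u (vf_in MQ q (fundamental MQ MG act xi)) c.
  rewrite /al2 (derive_slice1 xi oA (smooth_derive ((0, u) : 'rV[R]_k * V) sA) Ac).
  rewrite (schwarz _ _ oA sA Ac).
  rewrite -(derive_slice u oA (smooth_derive ((xi, 0) : 'rV[R]_k * V) sA) Ac).
  by apply: (derive_open_eq u img_open ic) => x ix; rewrite fundamental_in.
have FE : \forall s \near s0, F (q, u) = Fq (al1 s, al2 s).
  have oS : open [set s : 'rV[R]_k | adom q (s, c)].
    have cp : continuous (fun s : 'rV[R]_k => (s, c)).
      move=> s; have dp : differentiable (fun s : 'rV[R]_k => (s, c)) s.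
        by apply: differentiable_pair => //; exact: differentiable_cst.
      exact: differentiable_continuous dp.
    by apply: (@open_comp _ _ (fun s : 'rV[R]_k => (s, c)) _ _ oA) => w _; exact: cp.
  have : \forall s \near s0, adom q (s, c) by exact: (open_near oS).
  apply: filterS => s As; have [_ _] := As; rewrite /= (chartK cq) => dq.
  rewrite -(Finv (chart_inv MG one s)) /Fq /=.
  have T := @tchartK _ _ _ MQ q (tact MQ act (chart_inv MG one s) (q, u)) dq.
  have T2 : tchart MQ q (tact MQ act (chart_inv MG one s) (q, u)) = (al1 s, al2 s).
    rewrite (tchart_tact (g := chart_inv MG one s) (z := (q, u)) dq) /al2.
    by rewrite -(derive_slice u oA sA As) /al1 /product_rep /= (chartK cq).
  by rewrite -T2 T.
have dp := differentiable_pair d1 d2.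
have dF' : differentiable Fq (al1 s0, al2 s0) by rewrite e1 e2.
have := derive_comp xi dp dF'.
rewrite -(near_eq_derive xi FE) derive_cst (derive_pair xi d1 d2) D1 D2 e1 e2.
by move=> <-.
Qed.

End Action.

(** * The modified Lagrangian *)

Section Curve.
Context {R : realType} (n m : nat).
Local Notation V := 'rV[R]_n.
Variables (U : set V) (f : 'I_m -> V -> V) (c u : V) (v d : 'I_m -> R).
Hypothesis oU : open U.
Hypothesis sf : forall i, smooth_on U (f i).
Hypothesis Uc : U c.

(** Tangency concerns only the velocity at t = 0, so a straight base curve and coefficients affine
    in t suffice; no integral curve is required. *)
Definition curve_base (t : R) : V := c + t *: u.
Definition curve_fibre (t : R) : V := \sum_i (v i + t * d i) *: f i (curve_base t).
Definition curve_dom : set R := [set t | U (curve_base t)].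

Let smooth_id (A : set R) : smooth_on A (fun t : R => t : R).
Proof. by apply: (@smooth_lin _ R R A idfun) => ?; exact: cvg_id. Qed.

Lemma curve_base_smooth (A : set R) : open A -> smooth_on A curve_base.
Proof.
move=> oA; apply: smoothD => //; first exact: smooth_cst.
by apply: smoothZ => //; exact: smooth_cst.
Qed.

Lemma curve_dom_open : open curve_dom.
Proof.
apply: open_comp => // t _.
exact: (smooth_continuous (curve_base_smooth (@openT R))).
Qed.

Lemma curve_dom0 : curve_dom 0.
Proof. by rewrite /curve_dom /= /curve_base scale0r addr0. Qed.

Let sc : smooth_on curve_dom curve_base := curve_base_smooth curve_dom_open.

Let ss i : smooth_on curve_dom (fun t => v i + t * d i).
Proof.
have oD := curve_dom_open.
apply: smoothD => //; first exact: smooth_cst.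
by apply: smoothM => //; exact: smooth_cst.
Qed.

Let sfc i : smooth_on curve_dom (fun t => f i (curve_base t)).
Proof.
have oD := curve_dom_open.
by apply: (smooth_comp (B := U)) => //; exact: sc.
Qed.

Lemma curve_smooth : smooth_on curve_dom (fun t => (curve_base t, curve_fibre t)).
Proof.
have oD := curve_dom_open.
apply: smooth_pair => //; apply: smooth_sum => // i.
exact: (smoothZ oD (ss i) (sfc i)).
Qed.

Lemma curve_derive : 'D_1 (fun t => (curve_base t, curve_fibre t)) 0 =
  (u, \sum_i (d i *: f i c + v i *: 'D_u (f i) c)).
Proof.
have oD := curve_dom_open; have D0 := curve_dom0.
have b0 : curve_base 0 = c by rewrite /curve_base scale0r addr0.
have dt : differentiable (fun t : R => t : R) 0 by [].
have dtu : differentiable (fun t : R => t *: u) 0.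
  by apply: differentiable_scale => //; exact: differentiable_cst.
have dtu1 : 'D_1 (fun t : R => t *: u) 0 = u.
  have dcu : differentiable (fun _ : R => u) 0 by exact: differentiable_cst.
  by rewrite (derive_scale (1 : R) dt dcu) derive_cst derive_id scaler0 add0r scale1r.
have db1 : 'D_1 curve_base 0 = u.
  rewrite (@deriveD _ _ _ (fun=> c) (fun t : R => t *: u)); last exact: diff_derivable.
    by rewrite derive_cst add0r.
  exact: derivable_cst.
have ds i := smooth_differentiable (ss i) D0.
have dfc i := smooth_differentiable (sfc i) D0.
have dfib : differentiable curve_fibre 0.
  by apply: differentiable_bigsum => i; exact: differentiable_scale.
have db := smooth_differentiable sc D0.
rewrite (derive_pair (1 : R) db dfib) db1; congr (_, _).
rewrite derive_bigsum; last by move=> i; exact: differentiable_scale.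
apply: eq_bigr => i _; rewrite (derive_scale (1 : R) (ds i) (dfc i)) mul0r addr0 addrC.
have dfi : differentiable (f i) (curve_base 0) by rewrite b0; exact: smooth_differentiable (sf i) Uc.
rewrite (derive_comp (1 : R) db dfi) db1 b0; congr (_ *: _ + _).
have dtd : differentiable (fun t : R => t *: d i) 0.
  by apply: differentiable_scale => //; exact: differentiable_cst.
have dcd : differentiable (fun _ : R => d i) 0 by exact: differentiable_cst.
rewrite (@deriveD _ _ _ (fun=> v i) (fun t : R => t *: d i)); last exact: diff_derivable.
  by rewrite derive_cst add0r (derive_scale (1 : R) dt dcd) derive_cst derive_id scaler0 add0r scale1r.
exact: derivable_cst.
Qed.

End Curve.

(** * Regularity and invariance of L - p_a v^a on TQ *)

Section Main.
Context {R : realType} (m k : nat) (Q : topologicalType) (G : GroupSpace.type).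
Variables (MQ : manifold R (m + k) Q) (MG : manifold R k G) (act : G -> Q -> Q).
Local Notation n := (m + k)%N.
Local Notation V := 'rV[R]_n.
Local Notation TQ := (Q * V)%type.
Local Notation dom := (chart_dom MQ).
Local Notation ch := (chart MQ).
Local Notation inv := (chart_inv MQ).
Variables (L : TQ -> R) (D : Q -> {vspace V}).
Hypothesis hsys : chaplygin_system MQ MG act L D.
Variables (bg : k.-tuple 'rV[R]_k) (W : set Q) (X : 'I_m -> Q -> V).
Hypothesis hframe : adapted_frame MQ MG act bg W X D.

Local Notation fr := (frame MQ MG act bg X).
Local Notation E a := (E_ MQ MG act bg a).
Local Notation Lt := (Ltilde MQ MG act bg X L).
Local Notation O := (@Defs.over R m k Q W).
Local Notation fin p := (frame_in MQ fr p).
Local Notation Lp p := (L \o tchart_inv MQ p).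
Local Notation lt p := (local_Ltilde (fin p) (Lp p)).

Lemma frame_lshift al : fr (lshift k al) = X al.
Proof. by rewrite /frame (unsplitK (inl al)). Qed.

Lemma frame_rshift a : fr (rshift m a) = E a.
Proof. by rewrite /frame (unsplitK (inr a)). Qed.

Let lG := chaplygin_lie_group hsys.
Let aG := chaplygin_action hsys.
Let sG := chaplygin_action_smooth hsys.
Let oW : open W := frame_dom_open hframe.

Lemma frame_vf_smooth i : vf_smooth MQ W (fr i).
Proof.
rewrite -(splitK i); case: (fintype.split i) => j.
  by rewrite frame_lshift; exact: (frame_smooth hframe).
rewrite frame_rshift; exact: (fundamental_smooth aG sG).
Qed.

Lemma frame_fullv q : W q -> basis_of fullv [tuple fr i q | i < n].
Proof. exact: (frame_basis hframe). Qed.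

Let sfr := frame_vf_smooth.
Let bfr := frame_fullv.

Let oU p : open (chart_sub MQ p W).
Proof. exact: chart_sub_open. Qed.

Let sfin p i : smooth_on (chart_sub MQ p W) (fin p i).
Proof. exact: frame_in_smooth. Qed.

Let bfin p x : chart_sub MQ p W x -> basis_of fullv [tuple fin p i x | i < n].
Proof. exact: frame_in_basis. Qed.

Lemma over_topen : topen MQ O.
Proof.
move=> p; rewrite (_ : tchart_dom _ _ _ = local_tangent (chart_sub MQ p W)).
  exact: open_local_tangent.
by [].
Qed.

Let OW : O `<=` [set z : TQ | W z.1]. Proof. by []. Qed.

Lemma lagrangian_tsmooth : tsmooth MQ O L.
Proof.
by move=> p; apply: smooth_sub (chaplygin_smooth hsys p) => y [iy _]; split.
Qed.

Let sL := lagrangian_tsmooth.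

Lemma Ltilde_in p z : W z.1 -> dom p z.1 -> Lt z = lt p (tchart MQ p z).
Proof.
move=> Wz dz; have Az : tchart_dom MQ p O (tchart MQ p z) by exact: tchart_dom_tchart.
have dL := smooth_differentiable (@sL p) Az.
rewrite /Ltilde /local_Ltilde /= tchartK //; congr (_ - _).
have Em a : momentum MQ MG act bg L a z =
    local_vertical (fin p) (rshift m a) (Lp p) (tchart MQ p z).
  by rewrite /momentum /Vderiv -frame_rshift (vertical_in fr (rshift m a) dz dL).
have Ev a : quasi_velocity MQ MG act bg X (rshift m a) z =
    local_velocity (fin p) (rshift m a) (tchart MQ p z).
  exact: (velocity_in bfr).
by apply: eq_bigr => a _; rewrite Em Ev.
Qed.

Lemma Ltilde_in_eq p y : tchart_dom MQ p O y -> lt p y = Lt (tchart_inv MQ p y).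
Proof.
move=> [iy Wy]; have [dy _] := img_inv iy.
have T : tchart MQ p (tchart_inv MQ p y) = y := tchart_invK iy.
by rewrite (@Ltilde_in p (tchart_inv MQ p y) Wy dy) T.
Qed.

Lemma Ltilde_tsmooth : tsmooth MQ O Lt.
Proof.
move=> p; apply: (smooth_eq (@over_topen p) (@Ltilde_in_eq p)).
exact: (smooth_local_Ltilde (@oU p) (sfin p) (@bfin p) (@sL p)).
Qed.

Lemma constraint_velocity z a : W z.1 -> constraint_set D z ->
  coord [tuple fr i z.1 | i < n] (rshift m a) z.2 = 0.
Proof.
move=> Wz; rewrite /constraint_set /= (frame_span hframe Wz) => /coord_span ->.
rewrite linear_sum big1 // => al _; rewrite linearZ /= nth_mktuple.
have -> : X al z.1 = tnth [tuple fr i z.1 | i < n] (lshift k al).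
  by rewrite tnth_mktuple frame_lshift.
by rewrite coord_tnth ?eq_rlshift ?mulr0 //; exact: bfr.
Qed.

Lemma local_constraint_velocity p z a : W z.1 -> dom p z.1 -> constraint_set D z ->
  local_velocity (fin p) (rshift m a) (tchart MQ p z) = 0.
Proof. by move=> Wz dz Cz; rewrite -(@velocity_in _ _ _ MQ W fr bfr p (rshift m a) z Wz dz) constraint_velocity. Qed.

Lemma vertical_frame_in p i j z : W z.1 -> dom p z.1 ->
  Vderiv MQ (fr i) (Vderiv MQ (fr j) L) z =
  local_vertical (fin p) i (local_vertical (fin p) j (Lp p)) (tchart MQ p z).
Proof. by move=> Wz dz; exact: (vertical_vertical_in sfr over_topen OW sL). Qed.

Hypothesis hregD : regular_wrt_D MQ W X L D.
Hypothesis hregg : regular_wrt_g MQ MG act bg W L.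

Lemma local_regular_g p z : W z.1 -> dom p z.1 ->
  (\matrix_(a < k, b < k) local_vertical (fin p) (rshift m a)
    (local_vertical (fin p) (rshift m b) (Lp p)) (tchart MQ p z)) \in unitmx.
Proof.
move=> Wz dz; rewrite [Y in Y \in _](_ : _ = \matrix_(a < k, b < k) Vderiv MQ (E a) (Vderiv MQ (E b) L) z).
  exact: (hregg Wz).
apply: eq_mx => a b; have := vertical_frame_in (rshift m a) (rshift m b) Wz dz.
by rewrite !frame_rshift => ->.
Qed.

Lemma local_regular_D p z : W z.1 -> dom p z.1 -> constraint_set D z ->
  (\matrix_(a < m, b < m) local_vertical (fin p) (lshift k a)
    (local_vertical (fin p) (lshift k b) (Lp p)) (tchart MQ p z)) \in unitmx.
Proof.
move=> Wz dz Cz; rewrite [Y in Y \in _](_ : _ = \matrix_(a < m, b < m) Vderiv MQ (X a) (Vderiv MQ (X b) L) z).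
  exact: (hregD Wz Cz).
apply: eq_mx => a b; have := vertical_frame_in (lshift k a) (lshift k b) Wz dz.
by rewrite !frame_lshift => ->.
Qed.

(** The largest set over [W] on which the Hessian is nonsingular; it contains C over [W] and serves
    as the neighbourhood. *)
Definition regular_set : set TQ := [set z | W z.1 /\ hessian MQ Lt z \in unitmx].

Lemma local_hessian_Ltilde p y : tchart_dom MQ p O y ->
  local_hessian (Lt \o tchart_inv MQ p) y = local_hessian (lt p) y.
Proof.
move=> Ay; rewrite /local_hessian; apply: eq_mx => i j.
have oA := @over_topen p.
have E1 y' : tchart_dom MQ p O y' -> 'D_((0, delta_mx 0 j) : V * V) (Lt \o tchart_inv MQ p) y' =
    'D_((0, delta_mx 0 j) : V * V) (lt p) y'.
  by move=> Ay'; apply/esym; exact: (derive_open_eq _ oA Ay' (@Ltilde_in_eq p)).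
exact: (derive_open_eq _ oA Ay E1).
Qed.

Lemma constraint_regular : constraint_set D `&` O `<=` regular_set.
Proof.
move=> z [Cz Wz]; split=> //; have cz := chart_dom_center MQ z.1.
have Az : tchart_dom MQ z.1 O (tchart MQ z.1 z) by exact: tchart_dom_tchart.
rewrite (hessian_unit_chart over_topen Ltilde_tsmooth Wz cz) local_hessian_Ltilde //.
apply: (hessian_local_Ltilde_unit (@oU z.1) (sfin z.1) (@bfin z.1) (@sL z.1) Az).
- by move=> a; exact: local_constraint_velocity.
- exact: local_regular_g.
- exact: local_regular_D.
Qed.

Lemma regular_set_topen : topen MQ regular_set.
Proof.
move=> p; rewrite openE => y [iy [Wy Hy]].
have Ay : tchart_dom MQ p O y by split.
have T : tchart MQ p (tchart_inv MQ p y) = y := tchart_invK iy.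
(* The Hessian in the moving chart gives way to the one in the fixed chart at p, whose determinant
   is a smooth function of y'. *)
have HE y' : tchart_dom MQ p O y' -> hessian MQ Lt (tchart_inv MQ p y') \in unitmx =
    (\det (local_hessian (Lt \o tchart_inv MQ p) y') != 0).
  move=> [iy' Wy']; have [dy _] := img_inv iy'.
  rewrite (@hessian_unit_chart _ _ _ MQ O Lt p (tchart_inv MQ p y') over_topen Ltilde_tsmooth Wy' dy).
  by rewrite (tchart_invK iy') unitmxE unitfE.
pose d y' := \det (local_hessian (Lt \o tchart_inv MQ p) y').
have oA := @over_topen p.
have sd : smooth_on (tchart_dom MQ p O) d.
  apply: smooth_det => // i j; apply: smooth_hessian_entry.
  exact: (@Ltilde_tsmooth p).
have cd : {for y, continuous d} by exact: smooth_continuous sd Ay.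
have dy0 : d y != 0 by rewrite /d -HE.
have nA : \near y, tchart_dom MQ p O y by exact: open_near.
have nd : \near y, d y != 0.
  have nb : nbhs (d y) [set r : R | r != 0].
    by apply: open_nbhs_nbhs; split; [exact: open_neq|exact: dy0].
  exact: (cd _ nb).
apply: filterS2 nA nd => y' Ay' dy'.
have Hy' : hessian MQ Lt (tchart_inv MQ p y') \in unitmx by rewrite (HE _ Ay'); exact: dy'.
exact: (conj Ay'.1 (conj Ay'.2 Hy')).
Qed.

Lemma regular_nbhd : exists2 N, constraint_nbhd MQ W D N & regular_on MQ N Lt.
Proof.
exists regular_set; first split.
- exact: regular_set_topen.
- by move=> z [].
- exact: constraint_regular.
split; last by move=> z [].
by move=> p; apply: smooth_sub (@Ltilde_tsmooth p) => y [iy [Wy _]]; split.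
Qed.

Lemma tact_linear g q (c : R) u w :
  tmap MQ MQ (act g) q (c *: u + w) = c *: tmap MQ MQ (act g) q u + tmap MQ MQ (act g) q w.
Proof. exact/tmapP/(act_tdiff sG). Qed.

(* p_a v^a is the derivative of L along the vertical lift of vertical_part, and
   vertical_part commutes with the action although the frame fields E_a are not
   G-invariant. *)
Definition vertical_part (z : TQ) : V :=
  \sum_(a < k) coord [tuple fr i z.1 | i < n] (rshift m a) z.2 *: E a z.1.

(** Identifies [vertical_part] as the projection onto the vertical space along D, a description free
    of the frame. *)
Lemma vertical_partE q (d e : V) : W q -> d \in D q -> vertical_space MQ MG act q e ->
  vertical_part (q, d + e) = e.
Proof.
move=> Wq Dd [xi _ <-].
have -> : fundamental MQ MG act xi q = \sum_(a < k) coord bg a xi *: E a q.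
  rewrite [in LHS](coord_basis (frame_lie_basis hframe) (memvf xi)).
  rewrite (fundamental_sum sG); apply: eq_bigr => a _.
  by rewrite /E_ (tnth_nth 0).
have Ef a : E a q = tnth [tuple fr i q | i < n] (rshift m a).
  by rewrite tnth_mktuple frame_rshift.
rewrite /vertical_part /=; apply: eq_bigr => a _; congr (_ *: _).
rewrite linearD /= (@constraint_velocity (q, d) a Wq Dd) add0r linear_sum (bigD1 a) //=.
rewrite linearZ /= Ef coord_tnth ?eqxx ?mulr1; last exact: bfr.
rewrite big1 ?addr0 // => b ba; rewrite linearZ /= Ef coord_tnth; last exact: bfr.
by rewrite eq_rshift eq_sym (negbTE ba) mulr0.
Qed.

(** The tangent action preserves both summands, D by the definition of a principal connection and
    the vertical space by [tmap_fundamental]; it therefore commutes with the projection. *)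
Lemma vertical_part_tact g z : W z.1 ->
  vertical_part (tact MQ act g z) = tmap MQ MQ (act g) z.1 (vertical_part z).
Proof.
case: z => q u /= Wq; set e := vertical_part (q, u).
have [_ hsum _ hD] := chaplygin_connection hsys.
have [d Dd [xi _ xiE]] := hsum q u.
have uE : u = d + fundamental MQ MG act xi q by rewrite xiE addrC subrK.
have eE : e = fundamental MQ MG act xi q.
  by rewrite /e uE vertical_partE //; exists xi.
rewrite eE /tact /= uE.
rewrite -[d in LHS]scale1r tact_linear scale1r.
have [eta etaE] := tmap_fundamental lG aG sG g q xi.
rewrite vertical_partE //.
- exact: (frame_dom_invariant hframe).
- have : [set` D (act g q)] (tmap MQ MQ (act g) q d) by rewrite -hD; exists d.
  by [].
- by exists eta.
Qed.

Lemma tchart_inv_center q w : tchart_inv MQ q (ch q q, w) = (q, w).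
Proof.
have T := @tchartK _ _ _ MQ q (q, w) (chart_dom_center MQ q).
by rewrite -[RHS]T (@tchart_center _ _ _ MQ (q, w)).
Qed.

Lemma Ltilde_vertical z : W z.1 -> Lt z = L z -
  'D_((0, vertical_part z) : V * V) (L \o tchart_inv MQ z.1) (tcenter MQ z).
Proof.
move=> Wz; have cz := chart_dom_center MQ z.1.
have Az : tchart_dom MQ z.1 O (tchart MQ z.1 z) by exact: tchart_dom_tchart.
have dL := smooth_differentiable (@sL z.1) Az; rewrite tchart_center in dL.
rewrite /Ltilde /vertical_part; congr (_ - _).
have -> : ((0, \sum_(a < k) coord [tuple fr i z.1 | i < n] (rshift m a) z.2 *: E a z.1) : V * V) =
    \sum_(a < k) coord [tuple fr i z.1 | i < n] (rshift m a) z.2 *: ((0, E a z.1) : V * V).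
  transitivity (\sum_(a < k) ((0, coord [tuple fr i z.1 | i < n] (rshift m a) z.2 *: E a z.1) : V * V)).
    by rewrite pair_sum; congr (_, _); rewrite big1.
  by apply: eq_bigr => a _; congr (_, _); rewrite /= scaler0.
rewrite derive_dir_sum //; apply: eq_bigr => a _.
by rewrite derive_dirZ // mulrC.
Qed.

(** By invariance, L on the fibre over q is L on the fibre over g q composed with the linear tangent
    map; fibre derivatives along corresponding vertical parts then agree. *)
Lemma Ltilde_invariant : invariant_function_on MQ act W Lt.
Proof.
move=> g z Wz; have Wgz : W (act g z.1) by exact: (frame_dom_invariant hframe).
rewrite (Ltilde_vertical Wz) (@Ltilde_vertical (tact MQ act g z) Wgz).
have Linv := chaplygin_invariant hsys.
rewrite (Linv g z I); apply: (congr1 (fun t : R => L z - t)).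
rewrite (vertical_part_tact g Wz).
move: Wz Wgz; case: z => q u /= Wq Wgq.
have lin : linear (tmap MQ MQ (act g) q) by move=> a b c; exact: tact_linear.
have dM (w : V) : differentiable (linear_pack lin : V -> V) w.
  apply: linear_differentiable.
  have [_ da] := act_tdiff sG g q.
  (* The tangent map is itself the differential of a local representative, hence continuous. *)
  have -> : (linear_pack lin : V -> V) = 'd (fun x => ch (act g q) (act g (inv q x))) (ch q q).
    by apply/funext => b; rewrite -deriveE.
  exact: diff_continuous.
have Ac q' w : W q' -> tchart_dom MQ q' O (ch q' q', w).
  move=> Wq'; have := @tchart_dom_tchart _ _ _ MQ q' O (q', w) (chart_dom_center MQ q') Wq'.
  by rewrite (@tchart_center _ _ _ MQ (q', w)).
have LE w : (L \o tchart_inv MQ q) (ch q q, w) =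
   (L \o tchart_inv MQ (act g q)) (ch (act g q) (act g q), linear_pack lin w).
  by rewrite /= !tchart_inv_center; exact/esym/(Linv g (q, w) I).
rewrite /tcenter /tact /=; apply/esym; set b := vertical_part _.
have S1 := derive_slice b (@over_topen q) (@sL q) (Ac q u Wq).
have S2 := derive_slice_linear dM b (@sL (act g q)) (Ac _ (linear_pack lin u) Wgq).
rewrite -S1; apply: etrans S2; congr ('D_b _ u).
by apply/funext => w; exact: LE.
Qed.

(** * The Euler-Lagrange field and its tangency to C *)

Section Field.
Variable N : set TQ.
Hypothesis hN : constraint_nbhd MQ W D N.
Hypothesis rN : regular_on MQ N Lt.

Let oN : topen MQ N. Proof. by case: hN. Qed.
Let NW : N `<=` [set z : TQ | W z.1]. Proof. by case: hN. Qed.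
Let sLt : tsmooth MQ N Lt. Proof. by case: rN. Qed.
Local Notation Ltp p := (Lt \o tchart_inv MQ p).

(** Solves b H = force in the chart at the base point of each z. *)
Definition Ltilde_field (z : TQ) : V * V :=
  (z.2, local_force (Ltp z.1) (tcenter MQ z) *m invmx (hessian MQ Lt z)).
Local Notation Gam := Ltilde_field.

Let img_dom (p : Q) : set (V * V) := [set y | chart_img MQ p y.1].

Let img_dom_open p : open (img_dom p).
Proof. by apply: open_comp => [? _|]; [exact: cvg_fst|exact: chart_img_open]. Qed.

Lemma tvec_center (A : TQ -> V * V) z : tvec MQ z.1 A z = A z.
Proof.
have cz := chart_dom_center MQ z.1.
have oy : img_dom z.1 (tcenter MQ z) by exact: dom_img.
rewrite /tvec (derive_open_eq (g := id) _ (@img_dom_open z.1) oy) ?derive_id //.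
by move=> y iy; rewrite /= tchart_invK.
Qed.

Lemma Ltilde_field_center z : N z ->
  Gam z = (z.2, (Gam z).2) /\
  (Gam z).2 *m local_hessian (Ltp z.1) (tchart MQ z.1 z) =
    local_force (Ltp z.1) (tchart MQ z.1 z).
Proof.
move=> Nz; split=> //; rewrite tchart_center /=.
have Hz : hessian MQ Lt z \in unitmx by case: rN => _; exact.
exact: (mulmxKV Hz).
Qed.

Lemma Ltilde_field_eq z i : N z ->
  tderiv MQ Gam (fun z => tderiv MQ (vertical_lift (fr i)) Lt z) z -
  tderiv MQ (complete_lift MQ (fr i)) Lt z = 0.
Proof.
move=> Nz; have cz := chart_dom_center MQ z.1.
have [_ HE] := Ltilde_field_center Nz.
apply: (proj2 (euler_lagrange_in oW sfr bfr oN NW sLt Nz cz (erefl : (Gam z).1 = z.2))).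
by rewrite tvec_center.
Qed.

(** The definition uses a chart that varies with the point. Since the equations hold in every chart,
    the components in a fixed chart are the solution of b H = force there, which is smooth. *)
Lemma Ltilde_field_smooth : tvf_smooth MQ N Gam.
Proof.
move=> p; pose H y := local_hessian (Ltp p) y.
have Hu y : tchart_dom MQ p N y -> H y \in unitmx.
  move=> [iy Ny]; have [dy _] := img_inv iy.
  have := @hessian_unit_chart _ _ _ MQ N Lt p (tchart_inv MQ p y) oN sLt Ny dy.
  rewrite (tchart_invK iy) => <-; case: rN => _; exact.
apply: (smooth_eq (@oN p)) (smooth_euler_lagrange (@oN p) (@sLt p) Hu) => y Ay.
have [iy Ny] := Ay; have [dy _] := img_inv iy.
set z := tchart_inv MQ p y.
have T : tchart MQ p z = y := tchart_invK iy.
have := proj1 (euler_lagrange_in oW sfr bfr oN NW sLt Ny dy (erefl : (Gam z).1 = z.2))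
   (fun i => Ltilde_field_eq i Ny).
rewrite -/z T => EL.
have T1 : (tvec MQ p Gam z).1 = y.2.
  by transitivity ((tchart MQ p z).2); [rewrite tvec_eq|rewrite T].
transitivity (tvec MQ p Gam z); last by [].
rewrite [RHS]surjective_pairing T1; congr (_, _).
by rewrite -EL mulmxK //; exact: Hu.
Qed.

Lemma Ltilde_field_el : euler_lagrange_field MQ MG act bg X Lt N Gam.
Proof.
split; first by split; [exact: Ltilde_field_smooth|].
by move=> z Nz i; exact: Ltilde_field_eq.
Qed.

Lemma Ltilde_field_unique Gam' : euler_lagrange_field MQ MG act bg X Lt N Gam' ->
  forall z, N z -> Gam' z = Gam z.
Proof.
move=> [[_ so] el] z Nz; have cz := chart_dom_center MQ z.1.
have := proj1 (euler_lagrange_in oW sfr bfr oN NW sLt Nz cz (so z Nz)) (el z Nz).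
rewrite tvec_center => E'; have [_ E0] := Ltilde_field_center Nz.
rewrite [LHS]surjective_pairing (so z Nz) [RHS]surjective_pairing; congr (_, _).
have Hz : hessian MQ Lt z \in unitmx by case: rN => _; exact.
have Hz' : local_hessian (Ltp z.1) (tchart MQ z.1 z) \in unitmx by rewrite tchart_center.
by rewrite -[LHS](mulmxK Hz') E' -E0 (mulmxK Hz').
Qed.

Lemma Ltilde_field_velocity z : N z -> constraint_set D z -> forall a,
  'D_(Gam z) (local_velocity (fin z.1) (rshift m a)) (tchart MQ z.1 z) = 0.
Proof.
move=> Nz Cz; have cz := chart_dom_center MQ z.1; have Wz : W z.1 := NW Nz.
have AN : tchart_dom MQ z.1 N (tchart MQ z.1 z) by exact: tchart_dom_tchart.
have AO : tchart_dom MQ z.1 O (tchart MQ z.1 z) by exact: tchart_dom_tchart.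
have dLt := smooth_differentiable (@sLt z.1) AN.
have y2 : (tchart MQ z.1 z).2 = z.2 by rewrite tchart_center.
have [_ HE] := Ltilde_field_center Nz.
have GE : Gam z = ((tchart MQ z.1 z).2, (Gam z).2) by rewrite y2.
rewrite GE; apply: (derive_velocity_Ltilde (@oU z.1) (sfin z.1) (@bfin z.1) (@sL z.1) AO).
- by move=> a; exact: local_constraint_velocity.
- exact: local_regular_g.
move=> a; have oA := @oN z.1.
have NO : tchart_dom MQ z.1 N `<=` tchart_dom MQ z.1 O by move=> y [iy /NW Wy]; split.
have EV y : tchart_dom MQ z.1 N y -> local_vertical (fin z.1) (rshift m a) (lt z.1) y =
    local_vertical (fin z.1) (rshift m a) (Ltp z.1) y.
  move=> Ay; apply: (derive_open_eq _ oA Ay) => y' Ay'; exact: Ltilde_in_eq (NO _ Ay').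
rewrite (derive_open_eq _ oA AN EV).
(* In the equation along E_a the complete lift term is zero by invariance; what remains is the
   hypothesis of [derive_velocity_Ltilde]. *)
have := proj2 (euler_lagrange_iff (sfin z.1) (@bfin z.1) (Gam z).2 oA
  (tchart_dom_sub NW) (@sLt z.1) AN) HE (rshift m a).
rewrite -(complete_in oW sfr (rshift m a) Wz cz dLt) frame_rshift.
rewrite (complete_fundamental aG sG); first by rewrite subr0.
- by rewrite -tchart_center.
- by move=> g; exact: Ltilde_invariant.
Qed.

Lemma Ltilde_field_tangent z : N z -> constraint_set D z ->
  tangent_at MQ (constraint_set D) Gam z.
Proof.
move=> Nz Cz; have cz := chart_dom_center MQ z.1; have Wz : W z.1 := NW Nz.
have AO : tchart_dom MQ z.1 O (tchart MQ z.1 z) by exact: tchart_dom_tchart.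
have v0 a : local_velocity (fin z.1) (rshift m a) (tchart MQ z.1 z) = 0.
  exact: local_constraint_velocity.
have y2 : (tchart MQ z.1 z).2 = z.2 by rewrite tchart_center.
have GE : Gam z = ((tchart MQ z.1 z).2, (Gam z).2) by rewrite y2.
have dv := Ltilde_field_velocity Nz Cz; rewrite GE in dv.
have [uE bE] := tangent_local (@oU z.1) (sfin z.1) (@bfin z.1) AO v0 dv.
rewrite -GE y2 in bE; rewrite y2 in uE.
set f := fun al : 'I_m => fin z.1 (lshift k al).
set c := (tchart MQ z.1 z).1 in uE bE.
set v := fun al : 'I_m => local_velocity (fin z.1) (lshift k al) (tchart MQ z.1 z).
set d := fun al : 'I_m => 'D_(Gam z) (local_velocity (fin z.1) (lshift k al)) (tchart MQ z.1 z).
have sf al : smooth_on (chart_sub MQ z.1 W) (f al) by exact: sfin.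
have Uc : chart_sub MQ z.1 W c by exact: chart_sub_ch.
have oUz : open (chart_sub MQ z.1 W) by exact: oU.
(* The coefficients start at the quasi-velocities v^al of z and grow at the rates Gamma(v^al), which
   makes the velocity at 0 equal to [Gam z]. *)
pose bs := curve_base c z.2; pose fb := curve_fibre f c z.2 v d.
pose Idom := curve_dom (chart_sub MQ z.1 W) c z.2.
have oI : open Idom by exact: curve_dom_open.
have I0 : Idom 0 by exact: curve_dom0.
have b0 : bs 0 = c by rewrite /bs /curve_base scale0r addr0.
have f0 : fb 0 = z.2.
  rewrite /fb /curve_fibre -/(bs 0) b0 [RHS]uE; apply: eq_bigr => al _.
  by rewrite mul0r addr0.
have TT t : Idom t -> tchart MQ z.1 (tchart_inv MQ z.1 (bs t, fb t)) = (bs t, fb t).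
  by move=> [it _]; exact: (@tchart_invK _ _ _ MQ z.1 (bs t, fb t) it).
exists (fun t => tchart_inv MQ z.1 (bs t, fb t)), Idom; split.
- by [].
- rewrite b0 f0 -[RHS](tchartK cz); congr (tchart_inv MQ _ _).
  by rewrite [RHS]surjective_pairing y2.
- move=> t [it Wt]; have [dt et] := img_inv it; split=> //.
  rewrite /constraint_set /= (frame_span hframe Wt).
  set q' := inv z.1 (bs t).
  (* Membership in D is read in the chart at the moving base point q', so the X_al are transported
     there from the chart at z.1. *)
  have ot : chart_sub MQ z.1 (dom q') (bs t) by split=> //; exact: chart_dom_center.
  have dq' := transition_differentiable ot.
  rewrite /fb /curve_fibre derive_dir_sum //; apply: memv_suml => al _.
  rewrite derive_dirZ //; apply: memvZ; apply: memv_span.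
  have := vf_in_transition (X al) ot.
  rewrite -/q' vf_in_center => XE; apply/tnthP; exists al; rewrite tnth_mktuple XE.
  by rewrite /f /frame_in frame_lshift.
- have S : smooth_on Idom (fun t => (bs t, fb t)) by exact: curve_smooth.
  by apply: (smooth_eq oI) S => t It; rewrite /= TT.
- have E t : Idom t -> (tchart MQ z.1 \o (fun t => tchart_inv MQ z.1 (bs t, fb t))) t = (bs t, fb t).
    by move=> It; exact: TT.
  rewrite (derive_open_eq _ oI I0 E).
  rewrite (curve_derive z.2 v d oUz sf Uc) GE y2; congr (_, _).
  exact/esym/bE.
Qed.

End Field.
End Main.

(** Existence, uniqueness and tangency of the field are asserted on every neighbourhood of C on
    which the new function is regular, not only on the one exhibited by the first clause.
    Neighbourhoods are taken over the domain [W] of the frame. *)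
Theorem proposition5 (R : realType) (m k : nat)
    (Q : topologicalType) (G : GroupSpace.type)
    (MQ : manifold R (m + k) Q) (MG : manifold R k G) (act : G -> Q -> Q)
    (L : Q * 'rV[R]_(m + k) -> R) (D : Q -> {vspace 'rV[R]_(m + k)})
    (hsys : chaplygin_system MQ MG act L D)
    (bg : k.-tuple 'rV[R]_k) (W : set Q) (X : 'I_m -> Q -> 'rV[R]_(m + k))
    (hframe : adapted_frame MQ MG act bg W X D)
    (hregD : regular_wrt_D MQ W X L D)
    (hregg : regular_wrt_g MQ MG act bg W L) :
  let Lt := Ltilde MQ MG act bg X L in
  [/\ exists2 N : set (Q * 'rV[R]_(m + k)),
        constraint_nbhd MQ W D N & regular_on MQ N Lt,
      invariant_function_on MQ act W Lt
    & forall N : set (Q * 'rV[R]_(m + k)),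
        constraint_nbhd MQ W D N -> regular_on MQ N Lt ->
        exists Gam : Q * 'rV[R]_(m + k) -> 'rV[R]_(m + k) * 'rV[R]_(m + k),
          [/\ euler_lagrange_field MQ MG act bg X Lt N Gam,
              forall Gam', euler_lagrange_field MQ MG act bg X Lt N Gam' ->
                forall z, N z -> Gam' z = Gam z
            & forall z, N z -> constraint_set D z ->
                tangent_at MQ (constraint_set D) Gam z]].
Proof.
move=> Lt; split.
- exact: (regular_nbhd hsys hframe hregD hregg).
- exact: (Ltilde_invariant hsys hframe).
move=> N hN rN; exists (Ltilde_field MQ MG act L bg X); split.
- exact: (Ltilde_field_el hsys hframe).
- move=> Gam' el z Nz; exact: (Ltilde_field_unique hsys hframe hN rN el).
- move=> z Nz Cz; exact: (Ltilde_field_tangent hsys hframe hregg hN rN).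
Qed.
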